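(* Let $n\ge1$ be fixed, $\beta\in[0,1]$, and, for each dimension $d$, let $X_1,\ldots,X_n$ be a random sample (i.i.d.) from $N(0,\Sigma_d)$, where $\Sigma_d$ has eigenvalues $\lambda_1\ge\cdots\ge\lambda_d$ with orthonormal eigenvectors $u_1,\ldots,u_d$. Suppose that $u_1=(u_{1,1},\ldots,u_{d,1})^T$ with $u_{i,1}\neq0$ for $i=1,\ldots,\lfloor d^\beta\rfloor$ and $u_{i,1}=0$ otherwise. Suppose that: (a) $\lambda_1\sim d^\alpha$, $\lambda_2\sim d^\theta$ and $\sum_{i=2}^d\lambda_i\sim d$, where $\theta\in[0,\alpha)$ and $\alpha\in(0,1]$; (b) for a non-negative constant $C$, $\limsup_{d\to\infty}\frac{\lambda_1}{\sum_{i=2}^d\lambda_i}=C$, and $\frac{\sum_{i=1}^d\lambda_i^2}{(\sum_{i=1}^d\lambda_i)^2}\to0$ as $d\to\infty$; (c) $\max_{1\le i\le\lfloor d^\beta\rfloor}|u_{i,1}|^{-1}\sim d^{\eta/2}$, where $\eta\in[0,\alpha)$; (d) the vectors $H_j=\sum_{i=2}^d(X_j^Tu_i)u_i$, $j=1,\ldots,n$, which are i.i.d. $N(0,\Delta_d)$ with $\Delta_d=(m_{kl})_{d\times d}$, satisfy the mixing condition $$|m_{kl}|\le m_{kk}^{1/2}m_{ll}^{1/2}\rho_{|k-l|},\qquad 1\le k\ne l\le\lfloor d^\beta\rfloor,$$ where $\rho_t<1$ for all $t>1$ and $\rho_t\log t\to0$ as $t\to\infty$; (e) the threshold $\lambda=\lambda(d)$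 satisfies $(\log d)^\delta\,d^{\theta/2}\le\lambda\le d^{\gamma/2}$ for all sufficiently large $d$, where $\delta\in(\frac12,\infty)$ and $\gamma\in(\theta,\alpha-\eta)$. Then the simple thresholding estimator $\hat u_1^{\rm ST}$ with threshold $\lambda$ is consistent with $u_1$, i.e. $\arccos(|\langle\hat u_1^{\rm ST},u_1\rangle|)\to0$ in probability as $d\to\infty$.
   Context: All quantities are indexed by $d$; $n$ is fixed and $d\to\infty$. The symbols $\lambda_i$ with an index are eigenvalues of $\Sigma_d$; $\lambda$ without an index is the threshold. The sequence $(\rho_t)_{t\ge1}$ does not depend on $d$. Notation: $a_d\sim b_d$ means there are constants $0<c_1\le c_2<\infty$ with $c_1\le\liminf_{d\to\infty} a_d/b_d\le\limsup_{d\to\infty} a_d/b_d\le c_2$. Simple thresholding (ST) estimator: let $X_{(d)}=[X_1,\ldots,X_n]$ ($d\times n$), let $S_d=\frac1n X_{(d)}^TX_{(d)}$ be the dual sample covariance matrix and $\tilde v_1$ a unit eigenvector of $S_d$ for its largest eigenvalue. Put $\tilde u_1=(\tilde u_{1,1},\ldots,\tilde u_{d,1})^T=X_{(d)}\tilde v_1$. For a threshold $\lambda$, let $\breve u_{i,1}=\tilde u_{i,1}$ if $|\tilde u_{i,1}|>\lambda$ and $\breve u_{i,1}=0$ if $|\tilde u_{i,1}|\le\lambda$, $\breve u_1=(\breve u_{1,1},\ldots,\breve u_{d,1})^T$, and $\hat u_1^{\rm ST}=\breve u_1/\|\breve u_1\|$ (the zero vector if $\breve u_1=0$). *)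

(* Defs.v *)
From HB Require Import structures.
From mathcomp Require Import all_boot all_order all_algebra.
From mathcomp Require Import all_classical all_reals all_analysis.

Set Implicit Arguments.
Unset Strict Implicit.
Unset Printing Implicit Defensive.

Import Order.TTheory GRing.Theory Num.Theory.
Import numFieldNormedType.Exports.

Local Open Scope classical_set_scope.
Local Open Scope ring_scope.

Definition dot (R : realType) (m : nat) (x y : 'cV[R]_m) : R :=
  (x^T *m y) 0 0.

(* The Euclidean norm: MathComp-Analysis puts the sup norm on matrices. *)
Definition enorm (R : realType) (m : nat) (x : 'cV[R]_m) : R :=
  Num.sqrt (dot x x).

Definition same_order (R : realType) (a b : nat -> R) : Prop :=
  exists c1 c2 : R, [/\ 0 < c1, c1 <= c2,
    (c1%:E <= limn_einf (fun d => (a d / b d)%:E))%E &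
    (limn_esup (fun d => (a d / b d)%:E) <= c2%:E)%E].

Definition borel_cV (R : realType) (m : nat) : set (set 'cV[R]_m) :=
  <<s [set U : set 'cV[R]_m | open U] >>.

Definition random_vector (R : realType) (m : nat) (disp : measure_display)
    (T : measurableType disp) (X : T -> 'cV[R]_m) : Prop :=
  forall B : set 'cV[R]_m, borel_cV B -> measurable (X @^-1` B).

(* Some B j may be the whole space, so every subfamily is covered. *)
Definition independent_vectors (R : realType) (m n : nat)
    (disp : measure_display) (T : measurableType disp) (P : probability T R)
    (X : 'I_n -> T -> 'cV[R]_m) : Prop :=
  forall B : 'I_n -> set 'cV[R]_m, (forall j, borel_cV (B j)) ->
    (P (\bigcap_(j : 'I_n) (X j @^-1` B j))
     = \prod_(j < n) P (X j @^-1` B j))%E.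

(* N(mu, v) on the line. The second parameter of normal_prob is the standard
   deviation, and normal_prob mu 0 is not the Dirac mass at mu. *)
Definition normal_law (R : realType) (mu v : R) (A : set R) : \bar R :=
  if v == 0 then \d_mu A else normal_prob mu (Num.sqrt v) A.

(* X has law N(mu, Sigma), with Sigma possibly singular: every linear
   functional of X is normal with the corresponding mean and variance. *)
Definition mvnormal (R : realType) (m : nat) (disp : measure_display)
    (T : measurableType disp) (P : probability T R) (X : T -> 'cV[R]_m)
    (mu : 'cV[R]_m) (Sigma : 'M[R]_m) : Prop :=
  [/\ Sigma^T = Sigma, forall a : 'cV[R]_m, 0 <= dot a (Sigma *m a),
      random_vector X &
      forall (a : 'cV[R]_m) (A : set R), measurable A ->
        P ((fun w => dot a (X w)) @^-1` A)
        = normal_law (dot a mu) (dot a (Sigma *m a)) A].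

Definition iid_mvnormal (R : realType) (m n : nat) (disp : measure_display)
    (T : measurableType disp) (P : probability T R)
    (X : 'I_n -> T -> 'cV[R]_m) (mu : 'cV[R]_m) (Sigma : 'M[R]_m) : Prop :=
  independent_vectors P X /\ forall j, mvnormal P (X j) mu Sigma.

Definition data_matrix (R : realType) (m n : nat) (T : Type)
    (X : 'I_n -> T -> 'cV[R]_m) (w : T) : 'M[R]_(m, n) :=
  \matrix_(i, j) X j w i 0.

Definition dual_sample_cov (R : realType) (m n : nat) (Y : 'M[R]_(m, n)) :
    'M[R]_n :=
  n%:R^-1 *: (Y^T *m Y).

Definition unit_top_eigenvector (R : realType) (n : nat) (S : 'M[R]_n)
    (v : 'cV[R]_n) : Prop :=
  enorm v = 1 /\
  exists a : R, [/\ eigenvalue S a, forall b : R, eigenvalue S b -> b <= a &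
                    S *m v = a *: v].

Definition hard_threshold (R : realType) (m : nat) (t : R) (x : 'cV[R]_m) :
    'cV[R]_m :=
  \col_i (if t < `|x i 0| then x i 0 else 0).

(* As 0^-1 = 0, the zero vector is sent to itself. *)
Definition normalize (R : realType) (m : nat) (x : 'cV[R]_m) : 'cV[R]_m :=
  (enorm x)^-1 *: x.

Definition st_estimator (R : realType) (m n : nat) (Y : 'M[R]_(m, n))
    (v : 'cV[R]_n) (t : R) : 'cV[R]_m :=
  normalize (hard_threshold t (Y *m v)).

Definition cvg_in_probability_to0 (R : realType)
    (disp : nat -> measure_display) (T : forall d, measurableType (disp d))
    (P : forall d, probability (T d) R) (Z : forall d, T d -> R) : Prop :=
  forall eps : R, 0 < eps ->
    P d [set w | eps < `|Z d w|] @[d --> \oo] --> (0 : \bar R)%E.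

(* Main.v *)
Require Import Defs.
From HB Require Import structures.
From mathcomp Require Import all_boot all_order all_algebra.
From mathcomp Require Import all_classical all_reals all_analysis.
From mathcomp Require Import measurable_realfun ring lra.

Set Implicit Arguments.
Unset Strict Implicit.
Unset Printing Implicit Defensive.

Import Order.TTheory GRing.Theory Num.Theory.
Import numFieldNormedType.Exports.

Local Open Scope classical_set_scope.
Local Open Scope ring_scope.


(** Why the estimator is consistent.

    Let u be the first eigenvector, z_j the inner product of X_j with u, and
    split the data matrix as X = u z^T + A, where the columns of the noise
    matrix A are the projections of the X_j on the orthogonal complement of u.
    For the top unit eigenvector v of the dual covariance matrix,
    X v = (z.v) u + A v.  With a large constant K, two facts suffice.

    - No coordinate of A v exceeds the threshold.  The entries of A are centred
      Gaussian variables of variance at most lambda_2 = O(d^theta), and the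
      threshold exceeds the standard deviation by a factor (log d)^delta with
      2 delta > 1, so a union bound over the n d entries of A is enough
      ([mvnormal_tail_le], [orthogonal_form_le]).
    - The coefficient z.v is so large that every nonzero coordinate of (z.v) u
      exceeds K times the threshold.

    Then thresholding recovers the support of u exactly and disturbs each
    coordinate of (z.v) u by a fraction at most 1 / K of itself, so that the
    cosine of the angle is at least (K - 1) / (K + 1) ([hard_threshold_angle]).

    The second fact carries the proof.  The vector v maximises
    (z.x)^2 + |A x|^2 among the unit vectors x ([unit_top_eigenvector_max]).
    Comparing it with a unit vector w that maximises |A x|^2 gives
    |z.v| >= |z.w|.  Since w depends on A only and z is independent of A,
    z.w has law N(0, lambda_1), whence |z.w| < tau has probability
    O(tau / sqrt(lambda_1)), however large the fluctuations of A^T A may be.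
    A measurable choice of w is replaced by the choice of an almost maximising
    vector with integer coordinates, the first one in an enumeration
    ([small_ball]).  The growth conditions leave a power of d between the required
    size of z.v and sqrt(lambda_1).

    Independence of z and A has to be extracted from the laws of the linear
    functionals of the X_j.  These determine the expectation of cos(Y + c) for
    each joint linear functional Y ([Rintegral_iid_mvnormal_cos]), and this
    expectation factors because u is an eigenvector.  A uniqueness theorem of
    Cramer-Wold type ([eq_cos_eq_orthant]) turns this into a product formula on
    orthants, and the pi-lambda theorem extends it to all events determined by
    A ([gaussian_indep]). *)

(** * Changes of measure *)
Lemma bounded_integrable d (T : measurableType d) (R : realType)
    (mu : {finite_measure set T -> \bar R}) (f : T -> R)
    (M : R) :
  measurable_fun setT f -> (forall x, `|f x| <= M) ->
  mu.-integrable setT (EFin \o f).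
Proof.
move=> mf fM; apply: measurable_bounded_integrable => //.
  exact: fin_num_fun_lty.
exists M; split; first by rewrite num_real.
by move=> N MN x _ /=; rewrite (le_trans (fM x))// ltW.
Qed.

Section Densities.
Context d d' (T : measurableType d) (T' : measurableType d') (R : realType).

Import HBNNSimple.

(** If Y is a density of nu along Z, integrals against nu can be computed on the
    source of Z.  One statement covers the Gaussian density (Z is the identity),
    image measures (Y is constant) and independence of Y and Z (nu is the law of
    Z).  It holds by definition for indicators, hence for simple functions, and
    monotone convergence does the rest. *)
Lemma integral_density (mu : {measure set T -> \bar R})
    (nu : {measure set T' -> \bar R}) (Y : T -> R) (Z : T -> T')
    (f : T' -> \bar R) :
  measurable_fun setT Y -> (forall x, 0 <= Y x) -> measurable_fun setT Z ->
  (forall B, measurable B -> (\int[mu]_(x in Z @^-1` B) (Y x)%:E = nu B)%E) ->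
  measurable_fun [set: T'] f -> (forall y, (0 <= f y)%E) ->
  (\int[nu]_y f y = \int[mu]_x ((Y x)%:E * f (Z x)))%E.
Proof.
move=> mY Y0 mZ YZ mf f0.
pose h := nnsfun_approx measurableT mf.
have mEY : measurable_fun setT (EFin \o Y) by exact/measurable_EFinP.
have fE y : f y = limn (fun n => (h n y)%:E).
  by apply/esym/cvg_lim => //; exact: cvg_nnsfun_approx.
have mhZ n : measurable_fun setT (fun x => (h n (Z x))%:E).
  by apply/measurable_EFinP; apply: measurableT_comp.
transitivity (limn (fun n => \int[nu]_y (h n y)%:E)%E).
  rewrite -monotone_convergence//.
  - by apply: eq_integral => y _; exact: fE.
  - by move=> n; exact/measurable_EFinP.
  - by move=> n y _; rewrite lee_fin.
  - by move=> y _ a b ab; rewrite lee_fin; exact/lefP/nd_nnsfun_approx.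
transitivity (limn (fun n => \int[mu]_x ((Y x)%:E * (h n (Z x))%:E))%E);
    last first.
  rewrite -monotone_convergence//.
  - apply: eq_integral => x _; apply/cvg_lim => //; apply: cvgeZl => //.
    exact: cvg_nnsfun_approx.
  - by move=> n; apply: emeasurable_funM.
  - by move=> n x _; rewrite mule_ge0// lee_fin.
  - move=> x _ a b ab; rewrite lee_wpmul2l ?lee_fin//.
    exact/lefP/nd_nnsfun_approx.
apply: congr_lim; apply/funext => n.
transitivity (\sum_(y \in range (h n)) y%:E * nu (h n @^-1` [set y]))%E.
  rewrite integralT_nnsfun sintegralE; apply: eq_fsbigr => y _.
  by [].
under [RHS]eq_integral => x _.
  rewrite fimfunE -fsumEFin// ge0_mule_fsumr; last first.
    by move=> y; exact: nnfun_muleindic_ge0.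
  over.
rewrite ge0_integral_fsum//; last 2 first.
- move=> y; apply: emeasurable_funM => //; apply/measurable_EFinP.
  have mi : measurable_fun setT (fun t => y * \1_(h n @^-1` [set y]) t : R).
    exact: measurable_funM.
  exact: (measurableT_comp mi mZ).
- move=> y x _; apply: mule_ge0; first by rewrite lee_fin.
  exact: nnfun_muleindic_ge0.
apply: eq_fsbigr => y; rewrite inE => -[t _ <-].
under eq_integral do rewrite EFinM muleCA.
rewrite ge0_integralZl//; last 3 first.
- apply: emeasurable_funM => //; apply/measurable_EFinP.
  have mi : measurable_fun setT (\1_(h n @^-1` [set h n t]) : T' -> R).
    exact: measurable_indic.
  exact: (measurableT_comp mi mZ).
- by move=> x _; rewrite mule_ge0// lee_fin.
- by rewrite lee_fin.
congr *%E; rewrite -YZ//.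
rewrite integral_mkcond; apply: eq_integral => x _.
rewrite patchE indicE; have -> : (x \in Z @^-1` (h n @^-1` [set h n t])) =
  (Z x \in h n @^-1` [set h n t]) by apply/idP/idP; rewrite !inE.
by case: ifPn => _; rewrite ?mule1 ?mule0.
Qed.

(** The change of measure for bounded integrands of any sign, obtained by
    adding a constant to the integrand. *)
Lemma Rintegral_density (mu : {measure set T -> \bar R})
    (nu : {finite_measure set T' -> \bar R}) (Y : T -> R) (Z : T -> T')
    (f : T' -> R) (M : R) :
  measurable_fun setT Y -> (forall x, 0 <= Y x) -> measurable_fun setT Z ->
  (forall B, measurable B -> (\int[mu]_(x in Z @^-1` B) (Y x)%:E = nu B)%E) ->
  measurable_fun setT f -> (forall y, `|f y| <= M) ->
  \int[nu]_y f y = \int[mu]_x (Y x * f (Z x)).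
Proof.
move=> mY Y0 mZ YZ mf fM.
have iY : mu.-integrable setT (EFin \o Y).
  apply/integrableP; split; first exact/measurable_EFinP.
  under eq_integral do rewrite /= ger0_norm//.
  by rewrite -(preimage_setT Z) YZ// fin_num_fun_lty.
have mfZ : measurable_fun setT (f \o Z) by exact: measurableT_comp.
have iYf : mu.-integrable setT (EFin \o (fun x => Y x * f (Z x))).
  apply: (@le_integrable _ _ _ _ _ _ _ (EFin \o (fun x => M * Y x))) => //.
  - by apply/measurable_EFinP; exact: measurable_funM.
  - move=> x _; rewrite /= lee_fin normrM ger0_norm// mulrC.
    by rewrite [leRHS]ger0_norm ?ler_wpM2r// mulr_ge0// (le_trans _ (fM (Z x))).
  - by rewrite /comp; under eq_fun do rewrite EFinM; exact: integrableZl.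
have f1 : measurable_fun setT (fun y => f y + M) by exact: measurable_funD.
have E : (\int[nu]_y (f y + M)%:E = \int[mu]_x ((Y x)%:E * (f (Z x) + M)%:E))%E.
  apply: (integral_density mY Y0 mZ YZ); first exact/measurable_EFinP.
  move=> y; rewrite lee_fin -lerBlDr sub0r.
  by have := fM y; rewrite ler_norml => /andP[].
have E1 : \int[nu]_y (f y + M) = \int[mu]_x (Y x * f (Z x) + M * Y x).
  congr fine; rewrite E; apply: eq_integral => x _.
  by rewrite -EFinM mulrDr (mulrC _ M).
move: E1; rewrite RintegralD//; last 2 first.
- exact: bounded_integrable mf fM.
- apply: (@bounded_integrable _ _ _ _ _ M) => // y.
  by rewrite ger0_norm// (le_trans _ (fM y)).
rewrite RintegralD//; last first.
  by rewrite /comp; under eq_fun do rewrite EFinM; exact: integrableZl.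
rewrite RintegralZl// Rintegral_cst//.
suff -> : \int[mu]_x Y x = fine (nu setT) by move/addIr.
by rewrite /Rintegral -(preimage_setT Z) YZ.
Qed.

End Densities.

(** * The Fourier transform of the normal law *)
Section NormalFourier.
Context (R : realType).
Notation leb := (@lebesgue_measure R).

(** The fundamental theorem of calculus on growing symmetric intervals, with
    dominated convergence: the boundary terms of an integration by parts over
    the whole line disappear. *)
Lemma Rintegral_derivative_eq0 (F f : R -> R) :
  (forall x, is_derive x (1 : R) F (f x)) -> continuous f ->
  leb.-integrable setT (EFin \o f) ->
  F k%:R @[k --> \oo] --> 0 -> F (- k%:R) @[k --> \oo] --> 0 ->
  \int[leb]_x f x = 0.
Proof.
move=> Ff cf intf F1 F2.
pose I (k : nat) : set R := `[- k.+1%:R, k.+1%:R]%classic.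
have mf : measurable_fun setT (EFin \o f) by exact: measurable_int intf.
have lim1 : (\int[leb]_(x in I k) (f x)%:E)%E @[k --> \oo] -->
    (\int[leb]_x (f x)%:E)%E.
  have [|||||_ _] := @dominated_convergence _ _ R leb setT measurableT
    (fun k => (EFin \o f) \_ (I k)) (EFin \o f) (fun x => `|(f x)%:E|)%E.
  - move=> k; apply/(measurable_restrictT _ _).1 => //; first exact: measurable_itv.
    exact: (measurable_funS measurableT (@subsetT _ _) mf).
  - exact: mf.
  - apply: aeW => x _; apply: cvg_near_cst.
    near=> k; rewrite patchE mem_set// /I /= in_itv /=.
    have : `|x| <= k.+1%:R.
      rewrite (le_trans (ltW (archi_boundP (normr_ge0 x))))// ler_nat.
      by apply: leqW; near: k; exact: nbhs_infty_ge.
    by rewrite ler_norml.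
  - exact: integrable_abse.
  - apply: aeW => x k _; rewrite patchE; case: ifPn => // _.
    by rewrite abse0; exact: abse_ge0.
  by move=> h; under eq_cvg do rewrite integral_mkcond.
have lim2 : (\int[leb]_(x in I k) (f x)%:E)%E @[k --> \oo] --> 0%E.
  have E k : (\int[leb]_(x in I k) (f x)%:E = (F k.+1%:R - F (- k.+1%:R))%:E)%E.
    rewrite EFinB; apply: continuous_FTC2.
    - by rewrite (@lt_trans _ _ 0) ?oppr_lt0.
    - exact: continuous_subspaceT.
    - have cF x : {for x, continuous F}.
        apply/differentiable_continuous/derivable1_diffP.
        exact: (@ex_derive _ _ _ _ _ _ _ (Ff x)).
      split.
      + by move=> x _; exact: (@ex_derive _ _ _ _ _ _ _ (Ff x)).
      + exact/cvg_at_right_filter/cF.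
      + exact/cvg_at_left_filter/cF.
    - by move=> x _; rewrite derive1E (@derive_val _ _ _ _ _ _ _ (Ff x)).
  under eq_cvg do rewrite E.
  apply: cvg_EFin; first by near=> k.
  rewrite -[0 in X in _ --> X](subr0 0); apply: cvgB.
  - by move: F1; rewrite -(cvg_shiftS (fun k => F k%:R)).
  - by move: F2; rewrite -(cvg_shiftS (fun k => F (- k%:R))).
by rewrite /Rintegral (cvg_unique _ lim1 lim2).
Unshelve. all: by end_near. Qed.

Lemma continuous_cosM (t c : R) : continuous (fun x : R => cos (t * x + c)).
Proof.
move=> x; apply: (@continuous_comp _ _ _ (fun x => t * x + c) cos).
  by apply: cvgD; [exact: mulrl_continuous|exact: cvg_cst].
exact: continuous_cos.
Qed.

Lemma measurable_cosM (t c : R) :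
  measurable_fun setT (fun x : R => cos (t * x + c)).
Proof. by apply: continuous_measurable_fun; exact: continuous_cosM. Qed.

Lemma continuous_sinM (t c : R) : continuous (fun x : R => sin (t * x + c)).
Proof.
move=> x; apply: (@continuous_comp _ _ _ (fun x => t * x + c) sin).
  by apply: cvgD; [exact: mulrl_continuous|exact: cvg_cst].
exact: continuous_sin.
Qed.

Lemma measurable_sinM (t c : R) :
  measurable_fun setT (fun x : R => sin (t * x + c)).
Proof. by apply: continuous_measurable_fun; exact: continuous_sinM. Qed.

Section NonDegenerate.
Variables (s : R) (s0 : s != 0).
Let p := normal_pdf 0 s.

Let pE x : p x = normal_peak s * expR (- x ^+ 2 / (s ^+ 2 *+ 2)).
Proof. by rewrite /p normal_pdfE// /normal_fun subr0. Qed.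

Let s20 : s ^+ 2 != 0. Proof. by rewrite sqrf_eq0. Qed.
Let s2_gt0 : 0 < s ^+ 2. Proof. by rewrite exprn_even_gt0. Qed.

Lemma is_derive_normal_pdf (x : R) :
  is_derive x (1 : R) (normal_pdf 0 s) (- (x / s ^+ 2) * normal_pdf 0 s x).
Proof.
rewrite -/p (_ : p = fun x => normal_peak s * expR (- x ^+ 2 / (s ^+ 2 *+ 2)));
  last by apply/funext => y; exact: pE.
apply: is_derive_eq.
rewrite /GRing.scale /=; field.
by rewrite s0.
Qed.

(** A Gaussian density with twice the standard deviation absorbs the factor
    |x|.  This provides every domination and every decay needed below. *)
Lemma normr_normal_pdf_le : exists C : R, forall x : R,
  `|x| * normal_pdf 0 s x <= C * normal_pdf 0 (2 * s) x.
Proof.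
have ss0 : 2 * s != 0 by rewrite mulf_neq0.
have P0 : 0 < normal_peak (2 * s) by exact: normal_peak_gt0.
exists ((1 + 8 * s ^+ 2 / 3) * (normal_peak s / normal_peak (2 * s))) => x.
rewrite -/p pE (normal_pdfE _ ss0) /normal_fun subr0.
rewrite [leRHS](_ : _ = normal_peak s * ((1 + 8 * s ^+ 2 / 3) *
   expR (- x ^+ 2 / ((2 * s) ^+ 2 *+ 2)))); last first.
  by field; rewrite gt_eqF.
rewrite mulrCA ler_wpM2l ?normal_peak_ge0//.
rewrite (_ : - x ^+ 2 / (s ^+ 2 *+ 2) = - x ^+ 2 / ((2 * s) ^+ 2 *+ 2) -
   3 * x ^+ 2 / (8 * s ^+ 2)); last by field.
rewrite expRD mulrCA mulrC ler_wpM2r ?expR_ge0//.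
rewrite expRN ler_pdivrMr ?expR_gt0//.
set y := 3 * x ^+ 2 / (8 * s ^+ 2).
apply: (@le_trans _ _ ((1 + 8 * s ^+ 2 / 3) * (1 + y))); last first.
  by rewrite ler_wpM2l ?expR_ge1Dx// addr_ge0// divr_ge0// mulr_ge0// ltW.
have -> : (1 + 8 * s ^+ 2 / 3) * (1 + y) =
    1 + x ^+ 2 + (8 * s ^+ 2 / 3 + y) by rewrite /y; field.
have y0 : 0 <= 8 * s ^+ 2 / 3 + y.
  by rewrite /y addr_ge0// divr_ge0// mulr_ge0// ?sqr_ge0// ltW.
rewrite ler_wpDr// -(real_normK (num_real x)).
by have := sqr_ge0 (`|x| - 1); have := normr_ge0 x; nra.
Qed.

Lemma integrable_id_normal_pdf :
  leb.-integrable setT (fun x => (x * normal_pdf 0 s x)%:E).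
Proof.
have [C HC] := normr_normal_pdf_le.
have ig : leb.-integrable setT (fun x => (C%:E * (normal_pdf 0 (2 * s) x)%:E)%E).
  by apply: integrableZl => //; exact: integrable_normal_pdf.
apply: (le_integrable measurableT _ _ ig).
- apply/measurable_EFinP; apply: measurable_funM => //.
  exact: measurable_normal_pdf.
- move=> x _; have p0 := normal_pdf_ge0 0 s x.
  by rewrite /= lee_fin [leLHS]normrM (ger0_norm p0) (le_trans (HC x))// ler_norm.
Qed.

Let integrable_bounded_mul (g h : R -> R) :
  leb.-integrable setT (EFin \o g) -> measurable_fun setT h ->
  (forall x, `|h x| <= 1) -> leb.-integrable setT (EFin \o (fun x => g x * h x)).
Proof.
move=> ig mh h1; apply: (le_integrable measurableT _ _ ig).
- apply/measurable_EFinP; apply: measurable_funM => //.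
  by apply/measurable_EFinP; exact: measurable_int ig.
- by move=> x _; rewrite /= lee_fin normrM ler_piMr.
Qed.

Let integrable_p : leb.-integrable setT (EFin \o p).
Proof. exact: integrable_normal_pdf. Qed.

Let integrable_xp : leb.-integrable setT (EFin \o (fun x => x * p x)).
Proof. exact: integrable_id_normal_pdf. Qed.

Lemma normal_pdf_cvg0 (g : R -> R) : (forall x, `|g x| <= 1) ->
  (p k%:R * g k%:R @[k --> \oo] --> 0) /\
  (p (- k%:R) * g (- k%:R) @[k --> \oo] --> 0).
Proof.
move=> g1.
have [C HC] := normr_normal_pdf_le.
have D x : `|x| * `|p x * g x| <= C * normal_peak (2 * s).
  rewrite normrM (ger0_norm (normal_pdf_ge0 _ _ _)) mulrA.
  apply: (@le_trans _ _ (`|x| * p x)).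
    by rewrite ler_piMr// mulr_ge0// normal_pdf_ge0.
  have C0 : 0 <= C.
    have := HC 1; rewrite normr1 mul1r => h.
    have : 0 < normal_pdf 0 s 1.
      by rewrite -/p pE mulr_gt0 ?expR_gt0 ?normal_peak_gt0.
    move/lt_le_trans => /(_ _ h); rewrite normal_pdfE ?mulf_neq0// => h'.
    have P0 : 0 < normal_peak (2 * s) * normal_fun 0 (2 * s) 1.
      by rewrite mulr_gt0 ?expR_gt0 ?normal_peak_gt0// mulf_neq0.
    by move: h'; rewrite pmulr_lgt0// => /ltW.
  apply: le_trans (HC x) _; rewrite ler_wpM2l// normal_pdf_ub//.
  by rewrite mulf_neq0.
suff H (e : R) : `|e| = 1 -> p (e * k%:R) * g (e * k%:R) @[k --> \oo] --> 0.
  split.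
    by have := H 1; rewrite normr1 => /(_ erefl); under eq_cvg do rewrite mul1r.
  have := H (-1); rewrite normrN1 => /(_ erefl).
  by under eq_cvg do rewrite mulN1r.
move=> e1; apply: norm_cvg0.
have hl : C * normal_peak (2 * s) * (k%:R)^-1 @[k --> \oo] --> (0 : R).
  rewrite -(mulr0 (C * normal_peak (2 * s))); apply: cvgM; first exact: cvg_cst.
  apply/gtr0_cvgV0; last exact: cvgr_idn.
  by near=> k; rewrite ltr0n; near: k; exact: nbhs_infty_gt.
apply: (squeeze_cvgr _ (cvg_cst 0) hl).
near=> k; rewrite normr_ge0/= ler_pdivlMr; last first.
  by rewrite ltr0n; near: k; exact: nbhs_infty_gt.
by have := D (e * k%:R); rewrite (normrM e) e1 mul1r normr_nat mulrC.
Unshelve. all: by end_near. Qed.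

Let cosF (c t : R) := \int[leb]_x (p x * cos (t * x + c)).
Let sinF (c t : R) := \int[leb]_x (x * p x * sin (t * x + c)).

Let integrable_pcos t c :
  leb.-integrable setT (EFin \o (fun x => p x * cos (t * x + c))).
Proof.
apply: integrable_bounded_mul => //; first exact: measurable_cosM.
by move=> x; exact: cos_max.
Qed.

Let integrable_xpsin t c :
  leb.-integrable setT (EFin \o (fun x => x * p x * sin (t * x + c))).
Proof.
apply: integrable_bounded_mul => //; first exact: measurable_sinM.
by move=> x; exact: sin_max.
Qed.

(** Integration by parts: up to the factor - s^-2, x p(x) is the derivative of
    the density p. *)
Lemma normal_pdf_by_parts c t : sinF c t = s ^+ 2 * t * cosF c t.
Proof.
have H : \int[leb]_x (t * (p x * cos (t * x + c)) -
    (s ^+ 2)^-1 * (x * p x * sin (t * x + c))) = 0.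
  have [c1 c2] := @normal_pdf_cvg0 (fun x => sin (t * x + c))
    (fun x => sin_max _).
  apply: (@Rintegral_derivative_eq0 (fun x => p x * sin (t * x + c))) => //.
  - move=> x; have dp : is_derive x (1 : R) p (- (x / s ^+ 2) * p x).
      exact: is_derive_normal_pdf.
    apply: is_derive_eq.
    by rewrite /GRing.scale /=; field.
  - move=> x; apply: cvgB; apply: cvgM; try exact: cvg_cst.
    + apply: cvgM; first exact: continuous_normal_pdf.
      exact: continuous_cosM.
    + apply: cvgM; last exact: continuous_sinM.
      by apply: cvgM; [exact: cvg_id|exact: continuous_normal_pdf].
  - rewrite /comp; under eq_fun do rewrite EFinB !EFinM.
    apply: integrableB => //; apply: integrableZl => //.
      exact: integrable_pcos.
    exact: integrable_xpsin.
move: H; rewrite RintegralB//.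
- rewrite (RintegralZl _ measurableT (integrable_pcos t c)).
  rewrite (RintegralZl _ measurableT (integrable_xpsin t c)).
  rewrite -/(cosF c t) -/(sinF c t) => /subr0_eq h.
  by rewrite -mulrA h mulrA divff// mul1r.
- rewrite /comp; under eq_fun do rewrite EFinM.
  by apply: integrableZl => //; exact: integrable_pcos.
- rewrite /comp; under eq_fun do rewrite EFinM.
  by apply: integrableZl => //; exact: integrable_xpsin.
Qed.

Let is_derive_cosF c t : is_derive t (1 : R) (cosF c) (- sinF c t).
Proof.
pose f (t x : R) := p x * cos (t * x + c).
have df x y : is_derive x (1 : R) (f ^~ y) (- (y * p y * sin (x * y + c))).
  apply: is_derive_eq.
  by rewrite /GRing.scale /=; ring.
have d1E x y : partial1of2 f x y = - (y * p y * sin (x * y + c)).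
  by rewrite partial1of2E (@derive_val _ _ _ _ _ _ _ (df x y)).
have G0 y : 0 <= `|y * p y| by [].
have iG : leb.-integrable setT (EFin \o (fun y => `|y * p y|)).
  exact: (integrable_abse integrable_xp).
have t01 : `]t - 1, t + 1[%classic t by rewrite /= in_itv /=; lra.
have H1 x : `]t - 1, t + 1[%classic x -> leb.-integrable setT (EFin \o f x).
  by move=> _; exact: integrable_pcos.
have H2 x y : `]t - 1, t + 1[%classic x -> [set: R] y -> derivable (f ^~ y) x 1.
  by move=> _ _; exact: (@ex_derive _ _ _ _ _ _ _ (df x y)).
have H3 x y : `]t - 1, t + 1[%classic x -> [set: R] y ->
    `|partial1of2 f x y| <= `|y * p y|.
  by move=> _ _; rewrite d1E normrN normrM ler_piMr// sin_max.
have E : - sinF c t = derive1 (cosF c) t.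
  rewrite (differentiation_under_integral measurableT t01 H1 H2 G0 iG H3).
  rewrite /sinF -mulN1r -(RintegralZl _ measurableT (integrable_xpsin t c)).
  by apply: eq_Rintegral => y _; rewrite d1E mulN1r.
rewrite E derive1E; apply: derivableP.
exact: (derivable_under_integral measurableT t01 H1 H2 G0 iG H3).
Qed.

(** The phase c treats the cosine and the sine transforms together.  As a function
    of t the integral F satisfies F' = - s^2 t F, which is differentiation under
    the integral followed by [normal_pdf_by_parts]; so F(t) exp(s^2 t^2 / 2) is
    constant. *)
Lemma Rintegral_normal_cos (t c : R) :
  \int[normal_prob 0 s]_x cos (t * x + c) =
  cos c * expR (- (s ^+ 2 * t ^+ 2 / 2)).
Proof.
rewrite (@Rintegral_density _ _ _ _ _ leb (normal_prob 0 s) p id _ 1)//.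
- have dF u : is_derive u (1 : R)
      (fun u => cosF c u * expR (s ^+ 2 * u ^+ 2 / 2)) 0.
    have dc := is_derive_cosF c u.
    apply: is_derive_eq.
    by rewrite normal_pdf_by_parts /GRing.scale /=; field.
  have := @is_derive_0_is_cst _ _ t 0 dF; rewrite expr0n /= mulr0 mul0r expR0 mulr1.
  move=> E; have e0 : expR (s ^+ 2 * t ^+ 2 / 2) != 0 by rewrite gt_eqF// expR_gt0.
  rewrite expRN; apply: (mulIf e0); rewrite divfK//.
  rewrite -/(cosF c t) E /cosF.
  under eq_Rintegral do rewrite mul0r add0r mulrC.
  rewrite (RintegralZl _ measurableT integrable_p).
  by rewrite /Rintegral integral_normal_pdf mulr1.
- exact: measurable_normal_pdf.
- by move=> x; exact: normal_pdf_ge0.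
- exact: measurable_cosM.
- by move=> x; exact: cos_max.
Qed.

End NonDegenerate.

End NormalFourier.

(** * Tails and small intervals of normal laws *)
Section NormalTails.
Context (R : realType).
Notation leb := (@lebesgue_measure R).

(** Beyond t the density centred at 0 is at most exp(- t^2 / (2 s^2)) times the
    density centred at t, whose total mass is one. *)
Lemma normal_prob_tail_le (s t : R) : s != 0 -> 0 <= t ->
  (normal_prob 0 s [set x | (t < x)%R] <= (expR (- (t ^+ 2 / (2 * s ^+ 2))))%:E)%E.
Proof.
move=> s0 t0; have s2 : 0 < s ^+ 2 by rewrite exprn_even_gt0.
set e := expR _.
have mtail : measurable [set x : R | t < x].
  by rewrite -set_itvoy; exact: measurable_itv.
apply: (@le_trans _ _ (\int[leb]_(x in [set x | (t < x)%R])
    (e%:E * (normal_pdf t s x)%:E))%E).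
  apply: ge0_le_integral => //.
  - by move=> x _; rewrite lee_fin normal_pdf_ge0.
  - apply/measurable_funTS/measurable_EFinP; exact: measurable_normal_pdf.
  - apply/measurable_funTS; apply: emeasurable_funM => //.
    apply/measurable_EFinP; exact: measurable_normal_pdf.
  - move=> x /= tx; rewrite -EFinM lee_fin !(normal_pdfE _ s0) /normal_fun subr0.
    rewrite mulrCA ler_wpM2l ?normal_peak_ge0// /e -expRD ler_expR -subr_ge0.
    rewrite (_ : _ - _ = t * (x - t) / s ^+ 2); last by field.
    by rewrite divr_ge0// ?(ltW s2)// mulr_ge0// subr_ge0 ltW.
rewrite ge0_integralZl//; last 3 first.
- by apply/measurable_funTS/measurable_EFinP; exact: measurable_normal_pdf.
- by move=> x _; rewrite lee_fin normal_pdf_ge0.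
- by rewrite lee_fin expR_ge0.
rewrite -[leRHS]mule1 lee_wpmul2l ?lee_fin ?expR_ge0//.
exact: (@probability_le1 _ _ _ (normal_prob t s)).
Qed.

(** The density is bounded by 1 / s. *)
Lemma normal_prob_itv_le (s a b : R) : 0 < s -> a <= b ->
  (normal_prob 0 s `]a, b]%classic <= ((b - a) / s)%:E)%E.
Proof.
move=> s0 ab.
apply: (@le_trans _ _ (\int[leb]_(x in `]a, b]%classic) (s^-1)%:E)%E).
  apply: ge0_le_integral => //.
  - by move=> x _; rewrite lee_fin normal_pdf_ge0.
  - apply/measurable_funTS/measurable_EFinP; exact: measurable_normal_pdf.
  - move=> x _; rewrite lee_fin (le_trans (normal_pdf_ub _ _ _)) ?gt_eqF//.
    rewrite /normal_peak lef_pV2 ?posrE//; last first.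
      by rewrite sqrtr_gt0 pmulrn_lgt0// mulr_gt0 ?exprn_gt0 ?pi_gt0.
    rewrite -[leLHS](gtr0_norm s0) -sqrtr_sqr ler_wsqrtr//.
    rewrite -mulrnAr ler_peMr ?sqr_ge0//.
    by rewrite mulr2n ler_wpDr ?pi_ge0// (le_trans _ (pi_ge2 R))// ler1n.
rewrite integral_cst//= lebesgue_measure_itv/= lte_fin.
case: ifPn => [_|]; first by rewrite -EFinB -EFinM mulrC.
by rewrite mule0 lee_fin divr_ge0// ?subr_ge0// ltW.
Qed.

Lemma normal_law_tail_le (v v' t : R) : 0 <= v <= v' -> 0 < v' -> 0 <= t ->
  (normal_law 0 v [set x | (t < x)%R] <= (expR (- (t ^+ 2 / (2 * v'))))%:E)%E.
Proof.
move=> /andP[v0 vv'] v'0 t0; rewrite /normal_law.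
case: eqVneq => [_|vn0].
  by rewrite diracE memNset ?lee_fin ?expR_ge0//= ltNge t0.
have vp : 0 < v by rewrite lt_neqAle eq_sym vn0.
apply: le_trans (normal_prob_tail_le _ t0) _.
  by rewrite gt_eqF// sqrtr_gt0.
rewrite lee_fin ler_expR sqr_sqrtr// lerN2 ler_wpM2l ?sqr_ge0//.
by rewrite lef_pV2 ?posrE ?mulr_gt0// ler_wpM2l.
Qed.

End NormalTails.

Lemma measurable_fun_gt (R : realType) d (T : measurableType d) (f : T -> R) :
  (forall a, measurable [set w | a < f w]) -> measurable_fun setT f.
Proof.
move=> mf mD; apply: (measurability _ (RGenOInfty.measurableE R)) => //.
move=> _ [_ [a ->] <-]; rewrite setTI.
by rewrite (_ : _ @^-1` _ = [set w | a < f w])// set_itvoy.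
Qed.

Lemma measurable_gt (R : realType) d (T : measurableType d) (f : T -> R) a :
  measurable_fun setT f -> measurable [set w | a < f w].
Proof.
move=> mf; have := mf measurableT _ (measurable_itv `]a, +oo[).
by rewrite setTI set_itvoy.
Qed.

(** * Linear functionals of Gaussian vectors *)
Section RandomVectors.
Context (R : realType) (m : nat) (d : measure_display) (T : measurableType d).

Lemma dotE (x y : 'cV[R]_m) : dot x y = \sum_i x i 0 * y i 0.
Proof. by rewrite /dot mxE; apply: eq_bigr => i _; rewrite mxE. Qed.

Lemma dotv0 (x : 'cV[R]_m) : dot x 0 = 0.
Proof. by rewrite /dot mulmx0 mxE. Qed.

Lemma measurable_coord (X : T -> 'cV[R]_m) (i : 'I_m) :
  random_vector X -> measurable_fun setT (fun w => X w i 0).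
Proof.
move=> rX; apply: measurable_fun_gt => a.
apply: (rX [set x : 'cV[R]_m | a < x i 0]); apply: sub_sigma_algebra => /=.
rewrite (_ : [set x : 'cV[R]_m | _] =
    (fun x : 'cV[R]_m => x i 0) @^-1` [set y | a < y]) //.
apply: open_comp; last exact: open_gt.
by move=> x _; exact: coord_continuous.
Qed.

Lemma measurable_dot (X Y : T -> 'cV[R]_m) :
  (forall i, measurable_fun setT (fun w => X w i 0)) ->
  (forall i, measurable_fun setT (fun w => Y w i 0)) ->
  measurable_fun setT (fun w => dot (X w) (Y w)).
Proof.
move=> mX mY; rewrite (_ : (fun w => _) =
    fun w => \sum_(i < m) X w i 0 * Y w i 0); last first.
  by apply/funext => w; rewrite dotE.
by apply: measurable_sum => i; exact: measurable_funM.
Qed.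

Lemma measurable_dotl (X : T -> 'cV[R]_m) (a : 'cV[R]_m) :
  random_vector X -> measurable_fun setT (fun w => dot a (X w)).
Proof. by move=> rX; apply: measurable_dot => i //; exact: measurable_coord. Qed.

Variable P : probability T R.

Lemma Rintegral_mvnormal_cos (X : T -> 'cV[R]_m) (Sigma : 'M[R]_m) a c :
  mvnormal P X 0 Sigma ->
  \int[P]_w cos (dot a (X w) + c) =
  cos c * expR (- (dot a (Sigma *m a) / 2)).
Proof.
move=> [_ psd rX lawX]; set v := dot a (Sigma *m a).
have v0 : 0 <= v by exact: psd.
have mD := measurable_dotl a rX.
have mc : measurable_fun setT (fun x : R => cos (x + c)).
  by have := measurable_cosM 1 c; under eq_fun do rewrite mul1r.
have law A : measurable A -> (\int[P]_(w in (fun w => dot a (X w)) @^-1` A)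
    (cst 1 w)%:E)%E = normal_law 0 v A.
  move=> mA; rewrite -[LHS]/(integral P ((fun w => dot a (X w)) @^-1` A) (cst 1%E)).
  rewrite integral_cst ?mul1e; last first.
    by rewrite -[X in measurable X]setTI; exact: mD.
  transitivity (normal_law (dot a 0) v A); first exact: lawX.
  by rewrite dotv0.
have cosP (nu : probability (measurableTypeR R) R) :
    (forall A, measurable A -> normal_law 0 v A = nu A) ->
    \int[P]_w cos (dot a (X w) + c) = \int[nu]_x cos (x + c).
  move=> nuE; rewrite (@Rintegral_density _ _ _ _ _ P nu (cst 1)
    (fun w => dot a (X w)) _ 1)//.
  - by apply: eq_Rintegral => w _; rewrite mul1r.
  - by move=> A mA; rewrite law// nuE.
  - by move=> x; exact: cos_max.
have [vE|vn0] := eqVneq v 0.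
  rewrite (cosP (\d_(0 : measurableTypeR R))); last by move=> A mA; rewrite /normal_law vE eqxx.
  rewrite /Rintegral integral_dirac//; last exact/measurable_EFinP.
  by rewrite diracT mul1e/= add0r vE mul0r oppr0 expR0 mulr1.
have s0 : Num.sqrt v != 0 by rewrite gt_eqF// sqrtr_gt0 lt_neqAle eq_sym vn0.
rewrite (cosP (normal_prob 0 (Num.sqrt v))); last first.
  by move=> A mA; rewrite /normal_law (negbTE vn0).
have := Rintegral_normal_cos s0 1 c; rewrite expr1n mulr1 sqr_sqrtr// => <-.
by apply: eq_Rintegral => x _; rewrite mul1r.
Qed.

Lemma mvnormal_tail_le (X : T -> 'cV[R]_m) (Sigma : 'M[R]_m) a v' t :
  mvnormal P X 0 Sigma -> dot a (Sigma *m a) <= v' -> 0 < v' -> 0 <= t ->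
  (P [set w | (t < `|dot a (X w)|)%R] <=
   (2 * expR (- (t ^+ 2 / (2 * v'))))%:E)%E.
Proof.
move=> [_ psd rX lawX] vv' v'0 t0.
have m1 b : measurable [set w | t < dot b (X w)].
  exact/measurable_gt/measurable_dotl.
have one b : dot b (Sigma *m b) <= v' ->
    (P [set w | (t < dot b (X w))%R] <= (expR (- (t ^+ 2 / (2 * v'))))%:E)%E.
  move=> bv'; rewrite (_ : [set w | _] =
    (fun w => dot b (X w)) @^-1` [set x | t < x])//.
  rewrite lawX; last first.
    by rewrite -set_itvoy; exact: measurable_itv.
  rewrite dotv0.
  by apply: normal_law_tail_le => //; rewrite psd.
have E : [set w | t < `|dot a (X w)|] =
    [set w | t < dot a (X w)] `|` [set w | t < dot (- a) (X w)].
  apply/seteqP; split => w /=; rewrite lter_normr.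
    move/orP; case; [by left|right].
    by rewrite /dot linearN/= mulNmx mxE.
  move=> [->//|]; rewrite /dot linearN/= mulNmx mxE => ->; exact: orbT.
have U := measureU2 P (m1 a) (m1 (- a)).
rewrite E; apply: (le_trans U).
rewrite mulr_natl mulr2n EFinD leeD// one//.
by rewrite /dot linearN/= mulmxN mulNmx mulmxN opprK.
Qed.

End RandomVectors.

(** * Fourier transform of an independent sample *)
Section Independence.
Context (R : realType) (d : measure_display) (T : measurableType d).
Variable P : probability T R.

(** The test functions here have no sign, so Y is first turned into a probability
    density by adding a constant and dividing by the total mass K; the law of Z
    is unchanged under this density. *)
Lemma Rintegral_indep_mul (Y Z f : _ -> R) (M : R) :
  measurable_fun setT Y -> (forall w : T, `|Y w| <= M) ->
  measurable_fun setT Z ->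
  (forall B, measurable B -> \int[P]_(w in Z @^-1` B) Y w =
     \int[P]_w Y w * fine (P (Z @^-1` B))) ->
  measurable_fun setT f -> (forall x, `|f x| <= 1) ->
  \int[P]_w (Y w * f (Z w)) = \int[P]_w Y w * \int[P]_w f (Z w).
Proof.
move=> mY YM mZ YZ mf f1.
have iY : P.-integrable setT (EFin \o Y) by exact: bounded_integrable mY YM.
have iY1 : P.-integrable setT (EFin \o (fun w => Y w + (M + 1))).
  rewrite /comp; under eq_fun do rewrite EFinD.
  by apply: integrableD => //; exact: finite_measure_integrable_cst.
have if1 : P.-integrable setT (EFin \o (fun w => f (Z w))).
  by apply: (@bounded_integrable _ _ _ _ _ 1) => //; exact: measurableT_comp.
have iYf : P.-integrable setT (EFin \o (fun w => Y w * f (Z w))).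
  apply: (@bounded_integrable _ _ _ _ _ M).
    by apply: measurable_funM => //; exact: measurableT_comp.
  move=> w; rewrite normrM -[leRHS]mulr1 ler_pM//.
have M0 : 0 <= M := le_trans (normr_ge0 _) (YM point).
have Pfin A : measurable A -> P A = (fine (P A))%:E.
  by move=> mA; rewrite fineK// fin_num_measure.
have mpre B : measurable B -> measurable (Z @^-1` B).
  by move=> mB; rewrite -[X in measurable X]setTI; exact: mZ.
pose m := \int[P]_w Y w; pose K := m + (M + 1).
have K0 : 0 < K.
  have : \int[P]_w (- M) <= m.
    apply: le_Rintegral => //; first exact: finite_measure_integrable_cst.
    by move=> w _; have := YM w; rewrite ler_norml => /andP[].
  rewrite Rintegral_cst//= probability_setT mulr1 /K => h.
  by rewrite addrA ltr_pwDr// -lerBlDr sub0r.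
pose Z' : {RV P >-> R} :=
  MeasurableFun.Pack (MeasurableFun.Class (isMeasurableFun.Build _ _ _ _ Z mZ)).
have E1 : \int[distribution P Z']_x f x = \int[P]_w f (Z w).
  rewrite (@Rintegral_density _ _ _ _ _ P _ (cst 1) Z _ 1)//.
    by apply: eq_Rintegral => w _; rewrite mul1r.
  move=> B mB; rewrite -[LHS]/(integral P (Z @^-1` B) (cst 1%E)).
  by rewrite integral_cst ?mul1e//; exact: mpre.
have E2 : \int[distribution P Z']_x f x =
    \int[P]_w ((Y w + (M + 1)) / K * f (Z w)).
  apply: (@Rintegral_density _ _ _ _ _ P _ _ Z _ 1) => //.
  - by apply: measurable_funM => //; exact: measurable_funD.
  - move=> w; rewrite divr_ge0 ?(ltW K0)// addrA addr_ge0//.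
    by have := YM w; rewrite ler_norml => /andP[]; rewrite -lerBlDr sub0r.
  - move=> B mB; have mZB := mpre _ mB.
    have iS g : P.-integrable setT g -> P.-integrable (Z @^-1` B) g.
      by apply: integrableS.
    transitivity (\int[P]_(w in Z @^-1` B) ((Y w + (M + 1)) / K))%:E.
      rewrite /Rintegral fineK//; apply: integrable_fin_num => //.
      rewrite /comp; under eq_fun do rewrite EFinM.
      by apply: integrableZr => //; exact: iS.
    rewrite RintegralZr//; last exact: iS.
    rewrite RintegralD//; last 2 first.
    + exact: iS.
    + by apply: iS; exact: finite_measure_integrable_cst.
    rewrite YZ// Rintegral_cst// -/m -mulrDl mulrAC divff ?gt_eqF// mul1r.
    by rewrite -Pfin.
move: E2; rewrite E1.
under [RHS]eq_Rintegral do rewrite mulrAC mulrDl.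
rewrite RintegralZr//; last first.
  rewrite /comp; under eq_fun do rewrite EFinD EFinM.
  apply: integrableD => //; rewrite /comp; under eq_fun do rewrite EFinM.
  exact: integrableZl.
rewrite RintegralD//; last first.
  by rewrite /comp; under eq_fun do rewrite EFinM; exact: integrableZl.
rewrite RintegralZl// => /(congr1 ( *%R^~ K)); rewrite divfK ?gt_eqF//.
rewrite mulrC /K mulrDl -/m => /addIr <-.
by [].
Qed.

(** Independence is a product formula for events, whereas the cosine of a sum is
    not a product.  The phase c makes an induction possible: by the addition
    formula cos(S + A + c) is a combination of cos(S + c) and cos(S + c + pi / 2)
    with coefficients that depend on A only. *)
Lemma Rintegral_cos_sum_indep (n : nat) (A : 'I_n -> T -> R) (e : 'I_n -> R) :
  (forall j, measurable_fun setT (A j)) ->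
  (forall B : 'I_n -> set R, (forall j, measurable (B j)) ->
    (P (\bigcap_j (A j @^-1` B j)) = \prod_(j < n) P (A j @^-1` B j))%E) ->
  (forall j c, \int[P]_w cos (A j w + c) = cos c * e j) ->
  forall c, \int[P]_w cos (\sum_(j < n) A j w + c) = cos c * \prod_(j < n) e j.
Proof.
move=> mA indepA cosA.
have mpre j B : measurable B -> measurable (A j @^-1` B).
  by move=> mB; rewrite -[X in measurable X]setTI; exact: mA.
have mcap (B : 'I_n -> set R) : (forall j, measurable (B j)) ->
    measurable (\bigcap_j (A j @^-1` B j)).
  move=> mB; apply: fin_bigcap_measurable => [|j _]; last exact: mpre.
  exact: finite_finset.
have Pfin S : measurable S -> P S = (fine (P S))%:E.
  by move=> mS; rewrite fineK// fin_num_measure.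
(* The variables of index below k enter the sum; those of index at least k
   still enter through the events A j in B j. *)
suff H k : (k <= n)%N -> forall (c : R) (B : 'I_n -> set R),
    (forall j, measurable (B j)) -> (forall j : 'I_n, (j < k)%N -> B j = setT) ->
    \int[P]_(w in \bigcap_j (A j @^-1` B j))
       cos (\sum_(j < n | (j < k)%N) A j w + c) =
    cos c * \prod_(j < n | (j < k)%N) e j * \prod_(j < n) fine (P (A j @^-1` B j)).
  move=> c; have := H n (leqnn n) c (fun=> setT) (fun=> measurableT) (fun _ _ => erefl).
  rewrite (eq_bigl xpredT); last by move=> j; rewrite ltn_ord.
  rewrite [X in _ * X]big1 ?mulr1; last first.
    by move=> j _; rewrite preimage_setT probability_setT.
  move=> <-; rewrite (_ : \bigcap_(j in _) _ = setT); last first.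
    by apply/seteqP; split.
  by apply: eq_Rintegral => w _; congr (cos (_ + _)); apply: eq_bigl => j;
    rewrite ltn_ord.
elim: k => [_ c B mB _|k IH kn c B mB BT].
  under eq_Rintegral do rewrite big_pred0_eq add0r.
  rewrite Rintegral_cst ?big_pred0_eq ?mulr1//; last exact: mcap.
  rewrite /= indepA//; congr (_ * _).
  transitivity (fine (\prod_(j < n) (fine (P (A j @^-1` B j)))%:E)%E).
    by congr fine; apply: eq_bigr => j _; rewrite -Pfin//; exact: mpre.
  by rewrite prodEFin.
pose K := Ordinal kn; pose S w := \sum_(j < n | (j < k)%N) A j w.
pose E := \bigcap_j (A j @^-1` B j).
have mE : measurable E by exact: mcap.
have BK : B K = setT by apply: BT => /=.
have BT' (j : 'I_n) : (j < k)%N -> B j = setT by move=> jk; apply: BT; exact: ltnW.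
have lek (j : 'I_n) : (j < k.+1)%N = (j == K) || (j < k)%N.
  by rewrite ltnS leq_eqVlt -val_eqE.
have leK (j : 'I_n) : (j < k.+1)%N && (j != K) = (j < k)%N.
  by rewrite lek; case: eqVneq => [->|_]; rewrite ?ltnn ?andbT.
pose p := \prod_(j < n | (j < k)%N) e j * \prod_(j < n | j != K) fine (P (A j @^-1` B j)).
have mS c' : measurable_fun setT (fun w => cos (S w + c')).
  have mS1 : measurable_fun setT S.
    have mj (j : 'I_n) : measurable_fun setT
        (fun w => if (j < k)%N then A j w else 0) by case: (j < k)%N.
    have -> : S = fun w => \sum_(j < n) (if (j < k)%N then A j w else 0).
      by apply/funext => w; exact: big_mkcond.
    exact: measurable_sum.
  have := measurable_cosM 1 c'; under eq_fun do rewrite mul1r.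
  by move=> mc; apply: (measurableT_comp mc mS1).
have IHB c' B0 : measurable B0 ->
    \int[P]_(w in A K @^-1` B0) (cos (S w + c') * \1_E w) =
    cos c' * p * fine (P (A K @^-1` B0)).
  move=> mB0; pose B' j := if j == K then B0 else B j.
  have -> : \int[P]_(w in A K @^-1` B0) (cos (S w + c') * \1_E w) =
      \int[P]_(w in \bigcap_j (A j @^-1` B' j)) cos (S w + c').
    rewrite (_ : \bigcap_j (A j @^-1` B' j) = A K @^-1` B0 `&` E); last first.
      apply/seteqP; split=> w.
        move=> h; split; first by have := h K I; rewrite /B' eqxx.
        by move=> j _; have := h j I; rewrite /B'; case: eqP => // -> _; rewrite /= BK.
      by move=> [h1 h2] j _; rewrite /B'; case: eqP => [->//|_]; exact: h2.
    rewrite Rintegral_mkcondr; apply: eq_Rintegral => w _.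
    by rewrite patchE indicE; case: ifPn; rewrite ?mulr1 ?mulr0.
  have mB' j : measurable (B' j) by rewrite /B'; case: eqP.
  have hB' (j : 'I_n) : (j < k)%N -> B' j = setT.
    rewrite /B'; case: eqVneq => [->|_]; last exact: BT'.
    by rewrite ltnn.
  rewrite (IH (ltnW kn) c' B' mB' hB').
  rewrite [X in _ * X](bigD1 K)//= {1}/B' eqxx (mulrC (fine _)) !mulrA; congr (_ * _).
  rewrite /p; congr (_ * _).
  by apply: eq_bigr => j jK; rewrite /B' (negbTE jK).
have IHT c' : \int[P]_w (cos (S w + c') * \1_E w) = cos c' * p.
  have := IHB c' setT measurableT; rewrite preimage_setT => ->.
  by rewrite probability_setT mulr1.
have m1 c' : measurable_fun setT (fun w => cos (S w + c') * \1_E w : R).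
  by apply: measurable_funM => //; exact: measurable_indic.
have le1 c' w : `|cos (S w + c') * \1_E w| <= 1 :> R.
  rewrite normrM -[leRHS]mulr1 ler_pM// ?cos_max// indicE.
  by case: (_ \in _); rewrite ?normr1 ?normr0.
have step c' (f : R -> R) : measurable_fun setT f -> (forall x, `|f x| <= 1) ->
    \int[P]_w (cos (S w + c') * \1_E w * f (A K w)) =
    cos c' * p * \int[P]_w f (A K w).
  move=> mf f1; rewrite (@Rintegral_indep_mul _ (A K) f 1)// ?IHT//.
  by move=> B0 mB0; rewrite IHB// IHT.
have mcos : measurable_fun setT (@cos R).
  by apply: continuous_measurable_fun; exact: continuous_cos.
have msin : measurable_fun setT (@sin R).
  by apply: continuous_measurable_fun; exact: continuous_sin.
transitivity (\int[P]_w (cos (S w + c) * \1_E w * cos (A K w) +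
    cos (S w + (c + pi / 2)) * \1_E w * sin (A K w))).
  rewrite Rintegral_mkcond; apply: eq_Rintegral => w _.
  rewrite patchE indicE (addrA (S w)) cosDpihalf.
  have -> : \sum_(j < n | (j < k.+1)%N) A j w + c = (S w + c) + A K w.
    rewrite (bigD1 K) ?lek ?eqxx//= -addrA [RHS]addrC; congr (_ + (_ + _)).
    exact: eq_bigl.
  by case: ifPn => _; rewrite ?mulr1 ?mulr0 ?mul0r ?addr0// cosD mulNr.
have bint c' (f : R -> R) : measurable_fun setT f -> (forall x, `|f x| <= 1) ->
    P.-integrable setT (EFin \o (fun w => cos (S w + c') * \1_E w * f (A K w))).
  move=> mf f1; apply: (@bounded_integrable _ _ _ _ _ 1).
    by apply: measurable_funM => //; exact: (measurableT_comp mf (mA K)).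
  by move=> w; rewrite normrM -[leRHS]mulr1 ler_pM.
rewrite RintegralD//; last 2 first.
- by apply: bint => // x; exact: cos_max.
- by apply: bint => // x; exact: sin_max.
rewrite !step//; last 2 first.
- by move=> x; exact: sin_max.
- by move=> x; exact: cos_max.
have cA c' := cosA K c'.
have -> : \int[P]_w cos (A K w) = e K.
  have := cA 0; rewrite cos0 mul1r => <-.
  by apply: eq_Rintegral => w _; rewrite addr0.
have -> : \int[P]_w sin (A K w) = 0.
  have := cA (- (pi / 2)); rewrite cosN cos_pihalf mul0r => <-.
  by apply: eq_Rintegral => w _; rewrite -[in LHS](subrK (pi/2) (A K w)) sinDpihalf.
rewrite mulr0 addr0 /p.
rewrite (bigD1 K (P := fun j : 'I_n => (j < k.+1)%N)) ?lek ?eqxx//=.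
rewrite [in RHS](bigD1 K (P := predT))//= BK preimage_setT probability_setT mul1r.
by rewrite (eq_bigl _ _ leK); ring.
Qed.

End Independence.

(** Borel sets of vectors are generated by the open sets, so the identity on the
    space they generate is a random vector and [measurable_dotl] applies. *)
Lemma borel_cV_dot (R : realType) (m : nat) (a : 'cV[R]_m) (B : set R) :
  measurable B -> borel_cV ((fun x => dot a x) @^-1` B).
Proof.
move=> mB; pose T := g_sigma_algebraType [set U : set 'cV[R]_m | open U].
have idT : random_vector (idfun : T -> 'cV[R]_m) by [].
by have := measurable_dotl a idT measurableT mB; rewrite setTI.
Qed.

Lemma Rintegral_iid_mvnormal_cos (R : realType) (m n : nat)
    (d : measure_display) (T : measurableType d) (P : probability T R)
    (X : 'I_n -> T -> 'cV[R]_m) (Sigma : 'M[R]_m) (a : 'I_n -> 'cV[R]_m) c :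
  iid_mvnormal P X 0 Sigma ->
  \int[P]_w cos (\sum_(j < n) dot (a j) (X j w) + c) =
  cos c * expR (- (\sum_(j < n) dot (a j) (Sigma *m a j)) / 2).
Proof.
move=> [indX normX].
rewrite (@Rintegral_cos_sum_indep _ _ _ P n (fun j w => dot (a j) (X j w))
  (fun j => expR (- (dot (a j) (Sigma *m a j) / 2)))).
- by rewrite -expR_sum sumrN -mulr_suml mulNr.
- by move=> j; apply: measurable_dotl; have [] := normX j.
- move=> B mB; rewrite -(indX (fun j => (fun x => dot (a j) x) @^-1` B j))//.
  by move=> j; exact: borel_cV_dot.
- by move=> j c'; exact: Rintegral_mvnormal_cos.
Qed.

(** * Trigonometric polynomials *)
Section TrigonometricPolynomials.
Context (R : realType) (I : finType).
Implicit Types f g : (I -> R) -> R.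

(** Linear combinations of cosines of affine functions.  With arbitrary phases the sines are
    included, and the product formula for cosines makes this class an algebra;
    being linear combinations, its members have integrals determined by the
    Fourier transform. *)
Inductive trigpoly : ((I -> R) -> R) -> Prop :=
| trigpoly_cos (b : I -> R) (c : R) :
    trigpoly (fun x => cos (\sum_i b i * x i + c))
| trigpolyD f g : trigpoly f -> trigpoly g -> trigpoly (fun x => f x + g x)
| trigpolyZ (r : R) f : trigpoly f -> trigpoly (fun x => r * f x).

Lemma trigpoly_cst (r : R) : trigpoly (fun=> r).
Proof.
rewrite (_ : (fun=> r) = fun x : I -> R => r * cos (\sum_i 0 * x i + 0)).
  by apply: trigpolyZ; exact: trigpoly_cos.
apply/funext => x; rewrite addr0 big1 ?cos0 ?mulr1// => i _; exact: mul0r.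
Qed.

Lemma trigpolyM f g : trigpoly f -> trigpoly g -> trigpoly (fun x => f x * g x).
Proof.
move=> tf tg; elim: tf => [b c|f1 f2 _ h1 _ h2|r f1 _ h].
- elim: tg => [b' c'|g1 g2 _ h1 _ h2|r g1 _ h].
  + pose lin (b : I -> R) (x : I -> R) := \sum_i b i * x i.
    have linD b1 b2 x : lin (fun i => b1 i + b2 i) x = lin b1 x + lin b2 x.
      by rewrite -big_split; apply: eq_bigr => i _; rewrite mulrDl.
    have linN b1 x : lin (fun i => - b1 i) x = - lin b1 x.
      by rewrite -sumrN; apply: eq_bigr => i _; rewrite mulNr.
    rewrite (_ : (fun x => _) = fun x =>
      2^-1 * cos (lin (fun i => b i + b' i) x + (c + c')) +
      2^-1 * cos (lin (fun i => b i + - b' i) x + (c - c'))).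
      by apply: trigpolyD; apply: trigpolyZ; exact: trigpoly_cos.
    apply/funext => x; rewrite linD (linD b) linN -/(lin b x) -/(lin b' x).
    have -> : lin b x + lin b' x + (c + c') = (lin b x + c) + (lin b' x + c') by ring.
    have -> : lin b x + - lin b' x + (c - c') = (lin b x + c) - (lin b' x + c') by ring.
    move: (lin b x + c) (lin b' x + c') => u v.
    by rewrite cosB cosD; field.
  + under eq_fun do rewrite mulrDr; exact: trigpolyD.
  + under eq_fun do rewrite mulrCA; exact: trigpolyZ.
- under eq_fun do rewrite mulrDl; exact: trigpolyD.
- under eq_fun do rewrite -mulrA; exact: trigpolyZ.
Qed.

Lemma trigpoly_prod (F : I -> (I -> R) -> R) :
  (forall i, trigpoly (F i)) -> trigpoly (fun x => \prod_i F i x).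
Proof.
move=> tF; elim: (index_enum I) => [|i s IH].
  by under eq_fun do rewrite big_nil; exact: trigpoly_cst.
by under eq_fun do rewrite big_cons; exact: trigpolyM.
Qed.

Lemma trigpoly_coord_cos (i : I) (b c : R) :
  trigpoly (fun x => cos (b * x i + c)).
Proof.
rewrite (_ : (fun x => _) =
    fun x : I -> R => cos (\sum_j (if j == i then b else 0) * x j + c)).
  exact: trigpoly_cos.
apply/funext => x; rewrite (bigD1 i)//= eqxx big1 ?addr0// => j /negbTE ->.
exact: mul0r.
Qed.

(** The polynomial that maps [0, 1] to itself and whose only attracting fixed
    points there are 0 and 1: its iterates converge to a step at 1 / 2. *)
Definition smoothstep (y : R) := 3 * y ^+ 2 - 2 * y ^+ 3.

Lemma trigpoly_smoothstep f k :
  trigpoly f -> trigpoly (fun x => iter k smoothstep (f x)).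
Proof.
move=> tf; elim: k => [//|k IH] /=; rewrite /smoothstep.
pose g x := iter k smoothstep (f x).
rewrite (_ : (fun x => _) =
    fun x => 3 * (g x * g x) + (- 2) * (g x * (g x * g x))); last first.
  by apply/funext => x; rewrite -/(g x); ring.
by apply: trigpolyD; apply: trigpolyZ; do ?apply: trigpolyM.
Qed.

Lemma trigpoly_bounded f : trigpoly f -> exists M, forall x, `|f x| <= M.
Proof.
elim=> [b c|f1 f2 _ [M1 h1] _ [M2 h2]|r f1 _ [M h]].
- by exists 1 => x; exact: cos_max.
- by exists (M1 + M2) => x; rewrite (le_trans (ler_normD _ _))// lerD.
- by exists (`|r| * M) => x; rewrite normrM ler_wpM2l.
Qed.

End TrigonometricPolynomials.

(** * Iterates of the smoothstep polynomial *)
Section SmoothstepIterates.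
Context (R : realType).
Implicit Types y : R.

Lemma smoothstep_itv y : 0 <= y <= 1 -> 0 <= smoothstep y <= 1.
Proof.
move=> /andP[y0 y1]; apply/andP; split.
  rewrite (_ : smoothstep y = y ^+ 2 * (3 - 2 * y)); last by rewrite /smoothstep; ring.
  by rewrite mulr_ge0 ?sqr_ge0//; lra.
rewrite -subr_ge0 (_ : 1 - _ = (1 - y) ^+ 2 * (1 + 2 * y)); last first.
  by rewrite /smoothstep; ring.
by rewrite mulr_ge0 ?sqr_ge0//; lra.
Qed.

Lemma iter_smoothstep_itv y k : 0 <= y <= 1 -> 0 <= iter k (@smoothstep R) y <= 1.
Proof. by move=> y01; elim: k => //= k; exact: smoothstep_itv. Qed.

Lemma iter_smoothstep_onem y k :
  iter k (@smoothstep R) (1 - y) = 1 - iter k (@smoothstep R) y.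
Proof. by elim: k => //= k ->; rewrite /smoothstep; ring. Qed.

(** Here smoothstep y = y * (y * (3 - 2 y)), and the second factor increases with
    y and is below 1 when y < 1 / 2, so the iterates decrease geometrically. *)
Lemma iter_smoothstep_lt_half y : 0 <= y < 1 / 2 ->
  iter k (@smoothstep R) y @[k --> \oo] --> (0 : R).
Proof.
move=> /andP[y0 y12]; pose q := y * (3 - 2 * y).
have q0 : 0 <= q by rewrite /q; nra.
have q1 : q < 1 by rewrite /q; nra.
have H k : 0 <= iter k (@smoothstep R) y <= y * q ^+ k.
  elim: k => [|k IH]; first by rewrite expr0 mulr1/= y0 lexx.
  move: IH => /andP[z0 zq]; set z := iter k (@smoothstep R) y in z0 zq *.
  have zy : z <= y by apply: (le_trans zq); rewrite ler_piMr// exprn_ile1// ltW.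
  have -> : iter k.+1 (@smoothstep R) y = z * (z * (3 - 2 * z)).
    by rewrite /= -/z /smoothstep; ring.
  have r0 : 0 <= z * (3 - 2 * z) by nra.
  rewrite mulr_ge0//= exprSr [leRHS]mulrA ler_pM// /q.
  rewrite -subr_ge0 (_ : _ - _ = (y - z) * (3 - 2 * (y + z))); last by ring.
  by rewrite mulr_ge0//; lra.
have hl : y * q ^+ k @[k --> \oo] --> (0 : R).
  rewrite -(mulr0 y); apply: cvgM; first exact: cvg_cst.
  by apply: cvg_expr; rewrite ger0_norm.
by apply: (squeeze_cvgr _ (cvg_cst 0) hl); exact: nearW.
Qed.

(** The value 1 / 2 at 0 comes from the repelling fixed point 1 / 2 of the
    smoothstep polynomial. *)
Definition half_step y : R := if 0 < y then 1 else if y == 0 then 1 / 2 else 0.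

Lemma half_step_itv y : 0 <= half_step y <= 1.
Proof. by rewrite /half_step; case: ifP => _; [|case: ifP => _]; lra. Qed.

Lemma cvg_iter_smoothstep y : -1 <= y <= 1 ->
  iter k (@smoothstep R) ((1 + y) / 2) @[k --> \oo] --> half_step y.
Proof.
move=> /andP[y1 y2]; rewrite /half_step; case: ltrgtP => y0.
- rewrite (_ : (1 + y) / 2 = 1 - (1 - y) / 2); last by field.
  under eq_cvg do rewrite iter_smoothstep_onem.
  have /iter_smoothstep_lt_half h : 0 <= (1 - y) / 2 < 1 / 2 by lra.
  suff : 1 - iter k (@smoothstep R) ((1 - y) / 2) @[k --> \oo] --> (1 - 0 : R).
    by rewrite subr0.
  by apply: cvgB => //; exact: cvg_cst.
- by apply: iter_smoothstep_lt_half; lra.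
- rewrite -y0 addr0 (_ : (fun k => _) = fun=> 1 / 2); first exact: cvg_cst.
  by apply/funext; elim=> //= k ->; rewrite /smoothstep; field.
Qed.

End SmoothstepIterates.

(** * Uniqueness of laws with equal Fourier transforms *)
Section CramerWold.
Context (R : realType) (I : finType).
Context d1 d2 (T1 : measurableType d1) (T2 : measurableType d2).
Variables (P1 : probability T1 R) (P2 : probability T2 R).
Variables (Y1 : I -> T1 -> R) (Y2 : I -> T2 -> R).
Hypothesis mY1 : forall i, measurable_fun setT (Y1 i).
Hypothesis mY2 : forall i, measurable_fun setT (Y2 i).
Hypothesis same_cos : forall (b : I -> R) c,
  \int[P1]_w cos (\sum_i b i * Y1 i w + c) =
  \int[P2]_w cos (\sum_i b i * Y2 i w + c).

Let agree (f : (I -> R) -> R) :=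
  [/\ measurable_fun setT (fun w => f (Y1 ^~ w)),
      measurable_fun setT (fun w => f (Y2 ^~ w)) &
      \int[P1]_w f (Y1 ^~ w) = \int[P2]_w f (Y2 ^~ w)].

Let agree_trigpoly f : trigpoly f -> agree f.
Proof.
elim=> [b c|f1 f2 t1 [m11 m12 e1] t2 [m21 m22 e2]|r f1 t1 [m1 m2 e1]].
- have mcos : measurable_fun setT (fun x : R => cos (x + c)).
    by have := measurable_cosM 1 c; under eq_fun do rewrite mul1r.
  have ms d (T : measurableType d) (Y : I -> T -> R) :
      (forall i, measurable_fun setT (Y i)) ->
      measurable_fun setT (fun w => cos (\sum_i b i * Y i w + c)).
    move=> mY; apply: (measurableT_comp mcos); apply: measurable_sum => i.
    exact: measurable_funM.
  by split; [exact: ms|exact: ms|exact: same_cos].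
- have [M1 b1] := trigpoly_bounded t1; have [M2 b2] := trigpoly_bounded t2.
  split; [exact: measurable_funD|exact: measurable_funD|].
  by rewrite !RintegralD ?e1 ?e2//; apply: bounded_integrable => // x;
    (exact: b1 || exact: b2).
- have [M b] := trigpoly_bounded t1.
  split; [exact: measurable_funM|exact: measurable_funM|].
  by rewrite !RintegralZl ?e1//; apply: bounded_integrable => // x; exact: b.
Qed.

(** Indicators of orthants are reached from trigonometric polynomials by three
    successive bounded pointwise limits; each of them preserves equality of the
    expectations. *)
Let agree_lim (f_ : nat -> (I -> R) -> R) f : (forall k, agree (f_ k)) ->
  (forall k x, `|f_ k x| <= 1) -> (forall x, f_ k x @[k --> \oo] --> f x) ->
  agree f.
Proof.
move=> af b cf.
have lim d (T : measurableType d) (P : probability T R) (Y : I -> T -> R) :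
    (forall k, measurable_fun setT (fun w => f_ k (Y ^~ w))) ->
    measurable_fun setT (fun w => f (Y ^~ w)) /\
    (\int[P]_w f_ k (Y ^~ w) @[k --> \oo] --> \int[P]_w f (Y ^~ w)).
  move=> mf; have mlim : measurable_fun setT (fun w => f (Y ^~ w)).
    by apply: (measurable_fun_cvg mf) => w _; exact: cf.
  split => //.
  have [||||| if_ _ cv] := @dominated_convergence _ _ R P setT measurableT
    (fun k w => (f_ k (Y ^~ w))%:E) (fun w => (f (Y ^~ w))%:E) (cst 1%E).
  - by move=> k; exact/measurable_EFinP.
  - exact/measurable_EFinP.
  - by apply: aeW => w _; apply: cvg_EFin; [exact: nearW|exact: cf].
  - exact: finite_measure_integrable_cst.
  - by apply: aeW => w k _; rewrite lee_fin.
  apply: fine_cvg; rewrite fineK //; exact: integrable_fin_num.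
have [m1 c1] := lim _ _ P1 Y1 (fun k => let: And3 h _ _ := af k in h).
have [m2 c2] := lim _ _ P2 Y2 (fun k => let: And3 _ h _ := af k in h).
split => //; apply: (cvg_unique _ c1) => //.
rewrite (_ : (fun k => _) = fun k => \int[P2]_w f_ k (Y2 ^~ w)) //.
by apply/funext => k; case: (af k).
Qed.

Let cvg_prod (g_ : nat -> I -> R) (g : I -> R) :
  (forall i, g_ k i @[k --> \oo] --> g i) ->
  \prod_i g_ k i @[k --> \oo] --> \prod_i g i.
Proof.
move=> h; elim: (index_enum I) => [|i s IH].
  by under eq_cvg do rewrite big_nil; rewrite big_nil; exact: cvg_cst.
by under eq_cvg do rewrite big_cons; rewrite big_cons; apply: cvgM.
Qed.

Let prod_le1 (g : I -> R) : (forall i, 0 <= g i <= 1) -> `|\prod_i g i| <= 1.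
Proof.
move=> g01; rewrite ger0_norm; first by rewrite prodr_ile1.
by apply: prodr_ge0 => i _; have /andP[] := g01 i.
Qed.

(** The three limits.  Iterating smoothstep on (1 + sin((x - a) / m)) / 2 gives, in
    each coordinate, a step function of the sign of sin((x - a) / m); letting m
    grow turns this sign into the sign of x - a; and moving a to a + 1 / l, with
    l growing, corrects the value 1 / 2 at x = a. *)
Lemma eq_cos_eq_orthant (a : I -> R) :
  P1 (\bigcap_i [set w | a i < Y1 i w]) = P2 (\bigcap_i [set w | a i < Y2 i w]).
Proof.
have sin01 (y : R) : 0 <= (1 + sin y) / 2 <= 1.
  by have := sin_le1 y; have := sin_geN1 y; lra.
have A1 m (a' : I -> R) :
    agree (fun x => \prod_i half_step (sin ((x i - a' i) / m.+1%:R))).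
  (* The phase - pi / 2 turns the cosine of the trigonometric polynomial into
     the sine. *)
  apply: (@agree_lim (fun k x => \prod_i iter k (@smoothstep R)
     ((1 + sin ((x i - a' i) / m.+1%:R)) / 2))).
  - move=> k; apply: agree_trigpoly; apply: trigpoly_prod => i.
    apply: trigpoly_smoothstep.
    rewrite (_ : (fun x => _) = fun x : I -> R =>
      2^-1 + 2^-1 * cos (m.+1%:R^-1 * x i + (- (a' i / m.+1%:R) - pi / 2))).
      apply: trigpolyD; first exact: trigpoly_cst.
      by apply: trigpolyZ; exact: trigpoly_coord_cos.
    apply/funext => x.
    rewrite (_ : _ + (_ - _) = (x i - a' i) / m.+1%:R - pi / 2); last by ring.
    by rewrite cosBpihalf; field.
  - by move=> k x; apply: prod_le1 => i; exact: iter_smoothstep_itv.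
  - move=> x; apply: cvg_prod => i; apply: cvg_iter_smoothstep.
    by rewrite sin_le1 sin_geN1.
have A2 (a' : I -> R) : agree (fun x => \prod_i half_step (x i - a' i)).
  apply: (@agree_lim (fun m x =>
    \prod_i half_step (sin ((x i - a' i) / m.+1%:R)))) => //.
  - by move=> m x; apply: prod_le1 => i; exact: half_step_itv.
  - move=> x; apply: cvg_prod => i; move: (x i - a' i) => y.
    apply: cvg_near_cst; near=> m.
    have m0 : 0 < m.+1%:R :> R by rewrite ltr0n.
    have ym : `|y| < m.+1%:R.
      rewrite (lt_le_trans (archi_boundP (normr_ge0 y)))// ler_nat.
      by apply: leqW; near: m; exact: nbhs_infty_ge.
    have /andP[y1 y2] : -1 < y / m.+1%:R < 1.
      by rewrite -ltr_norml normrM (gtr0_norm (x := m.+1%:R^-1)) ?invr_gt0// ltr_pdivrMr// mul1r.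
    have pi1 : 1 < (pi : R) by rewrite (lt_le_trans _ (pi_ge2 R))// ltr1n.
    have zn : (y / m.+1%:R < 0) = (y < 0) by rewrite pmulr_llt0// invr_gt0.
    have zp : (0 < y / m.+1%:R) = (0 < y) by rewrite pmulr_lgt0// invr_gt0.
    have z0 : (y / m.+1%:R == 0) = (y == 0).
      by rewrite mulf_eq0 invr_eq0 pnatr_eq0 orbF.
    rewrite /half_step -zp -z0; move: (y / m.+1%:R) y1 y2 zn zp z0 => z z1 z2 _ _ _.
    case: (ltrgtP z 0) => z0.
    + have sz : sin z < 0 by rewrite -oppr_gt0 -sinN sin_gt0_pi//; lra.
      by rewrite ifF ?ifF// ?lt_eqF//; apply/negbTE; rewrite -leNgt ltW.
    + by rewrite sin_gt0_pi//; lra.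
    + by rewrite z0 sin0 ltxx eqxx.
have [] : agree (fun x => \prod_i (if a i < x i then 1 else 0)).
  apply: (@agree_lim (fun l x => \prod_i half_step (x i - (a i + l.+1%:R^-1)))) => //.
  - by move=> m x; apply: prod_le1 => i; exact: half_step_itv.
  - move=> x; apply: cvg_prod => i; apply: cvg_near_cst.
    have [h|h] := ltP (a i) (x i).
      have h' : 0 < x i - a i by rewrite subr_gt0.
      near=> l.
      have l0 : l.+1%:R^-1 < x i - a i by near: l; exact: near_infty_natSinv_lt (PosNum h').
      rewrite /half_step ifT//; move: (l.+1%:R^-1) l0 => z; lra.
    apply: nearW => l.
    have l0 : 0 < l.+1%:R^-1 :> R by rewrite invr_gt0 ltr0n.
    have xl : x i - (a i + l.+1%:R^-1) < 0 by move: (l.+1%:R^-1) l0 => z; lra.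
    by rewrite /half_step ifF ?ifF// ?lt_eqF//; apply/negbTE; rewrite -leNgt ltW.
have ind d (T : measurableType d) (P : probability T R) (Y : I -> T -> R) :
    (forall i, measurable_fun setT (Y i)) ->
    P (\bigcap_i [set w | a i < Y i w]) =
    (\int[P]_w \prod_i (if a i < Y i w then 1 else 0))%:E.
  move=> mY; have mS : measurable (\bigcap_i [set w | a i < Y i w]).
    apply: fin_bigcap_measurable => [|i _]; first exact: finite_finset.
    exact: measurable_gt.
  rewrite -(fineK (fin_num_measure P _ mS)); congr (fine _)%:E.
  rewrite -[in LHS](setIT (\bigcap_i _)) -integral_indic//.
  apply: eq_integral => w _; congr EFin; rewrite indicE.
  have [/set_mem h|h] := boolP (w \in \bigcap_i [set w | a i < Y i w]) => /=.
    by rewrite big1// => i _; rewrite ifT//; exact: h.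
  have [i hi] : exists i, ~ (a i < Y i w).
    by apply/existsNP => h'; move/negP: h; apply; rewrite inE => i _; exact: h'.
  by rewrite (bigD1 i)//= ifF ?mul0r//; apply/negP.
by move=> _ _ E; rewrite !ind// E.
Unshelve. all: by end_near. Qed.

End CramerWold.

(** * Independence of jointly Gaussian variables *)
Section SigmaAlgebraIndependence.
Context (R : realType) d (T : measurableType d) (P : probability T R).

Lemma indep_sigma_algebra (E : set T) (G : set (set T)) :
  measurable E -> setI_closed G -> G `<=` measurable ->
  (forall B, G B -> (P (E `&` B) = P E * P B)%E) ->
  forall D, <<s G >> D -> measurable D /\ (P (E `&` D) = P E * P D)%E.
Proof.
move=> mE GI Gm GE.
apply: (@lambda_system_subset _ G GI setT
  [set D | measurable D /\ (P (E `&` D) = P E * P D)%E]) => //; last first.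
  by move=> B GB; split; [exact: Gm|exact: GE].
apply/dynkin_lambda_system; split.
- by split; [exact: measurableT|rewrite setIT [X in (_ * X)%E]probability_setT mule1].
- move=> D [mD PD]; split; first exact: measurableC.
  rewrite -setDE measureD ?ltey_eq ?fin_num_measure//.
  rewrite [X in (_ * X)%E]probability_setC// muleBr ?mule1//.
    by congr (_ - _)%E; exact: PD.
  exact: fin_num_measure.
- move=> F tF HF; split; first by apply: bigcup_measurable => k _; case: (HF k).
  rewrite setI_bigcupr measure_bigcup//; last 2 first.
  + by move=> k _; apply: measurableI => //; case: (HF k).
  + exact: trivIset_setIl.
  rewrite [X in (_ * X)%E]measure_bigcup//; last by move=> k _; case: (HF k).
  have PE : P E = (fine (P E))%:E by rewrite fineK// fin_num_measure.
  rewrite PE -nneseriesZl//.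
  by apply: eq_eseriesr => k _; case: (HF k) => _ h; rewrite -PE; exact: h.
Qed.

End SigmaAlgebraIndependence.

Section GaussianIndependence.
Context (R : realType) d (T : measurableType d) (P : probability T R).
Variables (s : R) (s0 : 0 < s).

Definition orthants (J : Type) (H : J -> T -> R) : set (set T) :=
  [set B | exists a : J -> R, B = \bigcap_j [set w | a j < H j w]].

(** The factorisation of the Fourier transform says that (Y, H) has the Fourier
    transform of the product of N(0, s^2) and the law of H, which is realised on
    the product of the line and the probability space. *)
Lemma gaussian_orthant (J : finType) (Y : T -> R) (H : J -> T -> R) a0 a :
  measurable_fun setT Y -> (forall j, measurable_fun setT (H j)) ->
  (forall b0 b c, \int[P]_w cos (b0 * Y w + \sum_j b j * H j w + c) =
     expR (- (s ^+ 2 * b0 ^+ 2 / 2)) * \int[P]_w cos (\sum_j b j * H j w + c)) ->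
  (P ([set w | (a0 < Y w)%R] `&` \bigcap_j [set w | (a j < H j w)%R]) =
   normal_prob 0 s [set x | (a0 < x)%R] *
   P (\bigcap_j [set w | (a j < H j w)%R]))%E.
Proof.
move=> mY mH cosYH.
pose I := ('I_1 + J)%type.
pose Y1 (i : I) w := match i with inl _ => Y w | inr j => H j w end.
pose Y2 (i : I) (z : measurableTypeR R * T) :=
  match i with inl _ => z.1 : R | inr j => H j z.2 end.
pose a' (i : I) := match i with inl _ => a0 | inr j => a j end.
have mY1 i : measurable_fun setT (Y1 i) by case: i.
have mY2 i : measurable_fun setT (Y2 i).
  case: i => [i1|j]; first exact: measurable_fst.
  exact: (measurableT_comp (mH j) measurable_snd).
have sumE S (Z : I -> S -> R) (b : I -> R) x : \sum_i b i * Z i x =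
    b (inl ord0) * Z (inl ord0) x + \sum_j b (inr j) * Z (inr j) x.
  by rewrite big_sumType/= big_ord1.
have := @eq_cos_eq_orthant _ I _ _ _ _ P (normal_prob 0 s \x P)%E Y1 Y2 mY1 mY2.
move=> /(_ _ a').
have -> : \bigcap_i [set w | a' i < Y1 i w] =
    [set w | a0 < Y w] `&` \bigcap_j [set w | a j < H j w].
  apply/seteqP; split => w.
    by move=> h; split => [|j _]; [exact: (h (inl ord0) Logic.I)|exact: (h (inr j) Logic.I)].
  by move=> [h1 h2] [i|j] _; [exact: h1|exact: h2].
have -> : \bigcap_i [set w | a' i < Y2 i w] =
    [set x | a0 < x] `*` \bigcap_j [set w | a j < H j w].
  apply/seteqP; split => w.
    by move=> h; split => [|j _]; [exact: (h (inl ord0) Logic.I)|exact: (h (inr j) Logic.I)].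
  by move=> [h1 h2] [i|j] _; [exact: h1|exact: h2].
move=> ->.
  apply: product_measure1E.
    by rewrite -set_itvoy; exact: measurable_itv.
  apply: fin_bigcap_measurable => [|j _]; first exact: finite_finset.
  exact: measurable_gt.
move=> b c.
under eq_Rintegral do rewrite sumE.
under [RHS]eq_Rintegral do rewrite sumE /=.
rewrite cosYH.
set f := fun z : measurableTypeR R * T =>
  cos (b (inl ord0) * z.1 + \sum_j b (inr j) * H j z.2 + c).
have mlin : measurable_fun setT (fun w => \sum_j b (inr j) * H j w + c).
  apply: measurable_funD => //; apply: measurable_sum => j.
  exact: measurable_funM.
have mcos : measurable_fun setT (@cos R).
  by apply: continuous_measurable_fun; exact: continuous_cos.
have mf : measurable_fun setT f.
  apply: (measurableT_comp mcos).
  rewrite (_ : (fun z => _) = fun z : measurableTypeR R * T =>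
     b (inl ord0) * z.1 + (\sum_j b (inr j) * H j z.2 + c)); last first.
    by apply/funext => z; rewrite addrA.
  apply: measurable_funD; first by apply: measurable_funM.
  exact: (measurableT_comp mlin measurable_snd).
have intf := @bounded_integrable _ (measurableTypeR R * T)%type R
  (normal_prob 0 s \x P : probability _ _)%E f 1 mf (fun x => cos_max _).
rewrite [in RHS]/Rintegral -(integral21_prod_meas1 intf) /=.
transitivity (\int[P]_w (expR (- (s ^+ 2 * b (inl ord0) ^+ 2 / 2)) *
    cos (\sum_j b (inr j) * H j w + c))).
  rewrite RintegralZl//; apply: (@bounded_integrable _ _ _ _ _ 1) => //.
    exact: (measurableT_comp mcos mlin).
  by move=> x; exact: cos_max.
congr fine; apply: eq_integral => w _; rewrite /fubini_G /=.
have := @Rintegral_normal_cos R s (lt0r_neq0 s0) (b (inl ord0))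
  (\sum_j b (inr j) * H j w + c).
rewrite mulrC => <-; rewrite /Rintegral fineK.
  by apply: eq_integral => x _; rewrite /f /= addrA.
apply: integrable_fin_num => //.
apply: (@bounded_integrable _ _ _ _ _ 1); first exact: measurable_cosM.
by move=> x; exact: cos_max.
Qed.

Lemma orthantsI (J : Type) (H : J -> T -> R) : setI_closed (orthants H).
Proof.
move=> A B [a ->] [b ->]; exists (fun j => Num.max (a j) (b j)).
apply/seteqP; split => w.
  by move=> [h1 h2] j _; rewrite /= gt_max; apply/andP; split; [exact: h1|exact: h2].
by move=> h; split => j _; have := h j I; rewrite /= gt_max => /andP[].
Qed.

Lemma measurable_orthants (J : finType) (H : J -> T -> R) :
  (forall j, measurable_fun setT (H j)) -> orthants H `<=` measurable.
Proof.
move=> mH _ [a ->].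
apply: fin_bigcap_measurable => [|j _]; first exact: finite_finset.
exact: measurable_gt.
Qed.

(** A half-space in one coordinate is the increasing union of orthants whose other
    bounds go to minus infinity. *)
Lemma measurable_orthants_coord (J : finType) (H : J -> T -> R) (j : J) :
  measurable_fun setT (H j : g_sigma_algebraType (orthants H) -> R).
Proof.
apply: measurable_fun_gt => c.
pose a m i : R := if i == j then c else - m%:R.
rewrite (_ : [set w | _] = \bigcup_m \bigcap_i [set w | a m i < H i w]).
  by apply: bigcup_measurable => m _; apply: sub_sigma_algebra; exists (a m).
apply/seteqP; split => w /=.
  move=> cw; exists (\max_i Num.bound `|H i w|) => // i _ /=.
  rewrite /a; case: eqP => [->//|_].
  rewrite ltrNl (le_lt_trans (ler_norm _))// normrN.
  rewrite (lt_le_trans (archi_boundP (normr_ge0 _)))// ler_nat.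
  exact: (leq_bigmax i).
by move=> [m _ h]; have := h j I; rewrite /= /a eqxx.
Qed.

(** The empty family of coordinates identifies the law of Y alone; the pi-lambda
    theorem then passes from orthants to the sigma-algebra they generate. *)
Lemma gaussian_indep (J : finType) (Y : T -> R) (H : J -> T -> R) :
  measurable_fun setT Y -> (forall j, measurable_fun setT (H j)) ->
  (forall b0 b c, \int[P]_w cos (b0 * Y w + \sum_j b j * H j w + c) =
     expR (- (s ^+ 2 * b0 ^+ 2 / 2)) * \int[P]_w cos (\sum_j b j * H j w + c)) ->
  forall D a0, <<s orthants H >> D -> measurable D /\
    (P ([set w | (a0 < Y w)%R] `&` D) =
     normal_prob 0 s [set x | (a0 < x)%R] * P D)%E.
Proof.
move=> mY mH cosYH D a0 sD.
have PY : P [set w | (a0 < Y w)%R] = normal_prob 0 s [set x | (a0 < x)%R].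
  have := @gaussian_orthant 'I_0 Y (fun _ => Y) a0 (fun=> 0) mY (fun=> mY).
  have -> : \bigcap_(j in [set: 'I_0]) [set w | 0 < Y w] = setT.
    by apply/seteqP; split => // w _ [].
  rewrite setIT [X in (_ * X)%E]probability_setT mule1; apply => b0 b c.
  have Z w : \sum_j 0 * H j w = 0 :> R by apply: big1 => j _; exact: mul0r.
  transitivity (\int[P]_w cos (b0 * Y w + \sum_j 0 * H j w + c)).
    by apply: eq_Rintegral => w _; rewrite big_ord0 Z.
  rewrite cosYH; congr (_ * _).
  by apply: eq_Rintegral => w _; rewrite big_ord0 Z.
rewrite -PY; apply: indep_sigma_algebra sD.
- exact: measurable_gt.
- exact: orthantsI.
- exact: measurable_orthants.
- by move=> _ [a ->]; rewrite PY; exact: gaussian_orthant.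
Qed.

(** The closed interval [- t, t] is covered by ]- 2 t, t], a difference of two
    half-lines, to which [gaussian_indep] applies. *)
Lemma gaussian_anticoncentration (J : finType) (Y : T -> R) (H : J -> T -> R) :
  measurable_fun setT Y -> (forall j, measurable_fun setT (H j)) ->
  (forall b0 b c, \int[P]_w cos (b0 * Y w + \sum_j b j * H j w + c) =
     expR (- (s ^+ 2 * b0 ^+ 2 / 2)) * \int[P]_w cos (\sum_j b j * H j w + c)) ->
  forall D t, 0 < t -> <<s orthants H >> D ->
    (P ([set w | (`|Y w| <= t)%R] `&` D) <= (3 * t / s)%:E * P D)%E.
Proof.
move=> mY mH cosYH D t t0 sD.
have [mD PD1] := gaussian_indep mY mH cosYH (- (2 * t)) sD.
have [_ PD2] := gaussian_indep mY mH cosYH t sD.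
pose A := [set w | - (2 * t) < Y w] `&` D.
pose B := [set w | t < Y w] `&` D.
have mA : measurable A by apply: measurableI => //; exact: measurable_gt.
have mB : measurable B by apply: measurableI => //; exact: measurable_gt.
have mle : measurable [set w | `|Y w| <= t].
  rewrite (_ : [set w | _] = ~` [set w | t < `|Y w|]).
    by apply: measurableC; apply: measurable_gt; exact: measurableT_comp.
  by apply/seteqP; split => w /=; rewrite leNgt => /negP.
have BA : B `<=` A.
  by move=> w [/= h Dw]; split => //=; lra.
have sub : [set w | `|Y w| <= t] `&` D `<=` A `\` B.
  move=> w [/=]; rewrite ler_norml => /andP[h1 h2] Dw; split.
    by split => //=; lra.
  by move=> [/= h _]; lra.
apply: (@le_trans _ _ (P (A `\` B))).
  by apply: le_measure => //; rewrite inE; [exact: measurableI|exact: measurableD].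
rewrite measureD//; last by rewrite ltey_eq fin_num_measure.
rewrite (setIidr BA) [X in (X - _)%E]PD1 [X in (_ - X)%E]PD2.
have mN a : measurable [set x : R | a < x].
  by rewrite -set_itvoy; exact: measurable_itv.
rewrite -muleBl; last 2 first.
- by rewrite fin_num_measure.
- apply: fin_num_adde_defr; exact: (fin_num_measure (normal_prob 0 s) _ (mN _)).
rewrite lee_wpmul2r//.
have NBA : [set x : R | t < x] `<=` [set x | - (2 * t) < x] by move=> x /=; lra.
have <- : normal_prob 0 s ([set x : R | - (2 * t) < x] `\` [set x | t < x]) =
    (normal_prob 0 s [set x | (- (2 * t) < x)%R] -
     normal_prob 0 s [set x | (t < x)%R])%E.
  rewrite measureD; [by rewrite (setIidr NBA)|exact: mN|exact: mN|].
  by rewrite ltey_eq (fin_num_measure (normal_prob 0 s) _ (mN _)).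
rewrite (_ : _ `\` _ = `]- (2 * t), t]%classic).
  rewrite (le_trans (normal_prob_itv_le s0 _))//; first by lra.
  by rewrite lee_fin ler_wpM2r ?invr_ge0 ?(ltW s0)//; lra.
apply/seteqP; split => x /=; rewrite in_itv/=.
  by move=> [-> /negP]; rewrite -leNgt.
by move=> /andP[-> h]; split => //; apply/negP; rewrite -leNgt.
Qed.

End GaussianIndependence.

(** * Euclidean geometry and quadratic forms *)
Section DotProduct.
Context (R : realType) (m : nat).
Implicit Types x y z : 'cV[R]_m.

Lemma dotC x y : dot x y = dot y x.
Proof. by rewrite !dotE; apply: eq_bigr => i _; rewrite mulrC. Qed.

Lemma dotDr x y z : dot x (y + z) = dot x y + dot x z.
Proof. by rewrite /dot mulmxDr mxE. Qed.

Lemma dotDl x y z : dot (y + z) x = dot y x + dot z x.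
Proof. by rewrite -dotC dotDr !(dotC x). Qed.

Lemma dotZr c x y : dot x (c *: y) = c * dot x y.
Proof. by rewrite /dot -scalemxAr mxE. Qed.

Lemma dotZl c x y : dot (c *: x) y = c * dot x y.
Proof. by rewrite dotC dotZr dotC. Qed.

Lemma dotNr x y : dot x (- y) = - dot x y.
Proof. by rewrite -scaleN1r dotZr mulN1r. Qed.

Lemma dotNl x y : dot (- x) y = - dot x y.
Proof. by rewrite dotC dotNr dotC. Qed.

Lemma dotBr x y z : dot x (y - z) = dot x y - dot x z.
Proof. by rewrite dotDr dotNr. Qed.

Lemma dotBl x y z : dot (y - z) x = dot y x - dot z x.
Proof. by rewrite dotDl dotNl. Qed.

Lemma dot0v x : dot 0 x = 0.
Proof. by rewrite dotC dotv0. Qed.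

Lemma dot_sumr (I : Type) (s : seq I) (p : pred I) (F : I -> 'cV[R]_m) x :
  dot x (\sum_(i <- s | p i) F i) = \sum_(i <- s | p i) dot x (F i).
Proof. by apply: (big_morph (dot x)) => [y z|]; [exact: dotDr|exact: dotv0]. Qed.

Lemma dot_suml (I : Type) (s : seq I) (p : pred I) (F : I -> 'cV[R]_m) x :
  dot (\sum_(i <- s | p i) F i) x = \sum_(i <- s | p i) dot (F i) x.
Proof. by rewrite dotC dot_sumr; apply: eq_bigr => i _; rewrite dotC. Qed.

Lemma dot_ge0 x : 0 <= dot x x.
Proof. by rewrite dotE; apply: sumr_ge0 => i _; rewrite -expr2 sqr_ge0. Qed.

Lemma dot_eq0 x : (dot x x == 0) = (x == 0).
Proof.
apply/eqP/eqP => [|->]; last exact: dotv0.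
move/eqP; rewrite dotE psumr_eq0; last by move=> i _; rewrite -expr2 sqr_ge0.
move=> /allP h; apply/matrixP => i j; rewrite ord1 mxE.
by have := h i (mem_index_enum i); rewrite -expr2 sqrf_eq0 => /eqP.
Qed.

Lemma enorm_ge0 x : 0 <= enorm x.
Proof. exact: sqrtr_ge0. Qed.

Lemma sqr_enorm x : enorm x ^+ 2 = dot x x.
Proof. by rewrite /enorm sqr_sqrtr// dot_ge0. Qed.

(** Cauchy-Schwarz, from the square of a norm being nonnegative. *)
Lemma sqr_dot_le x y : dot x y ^+ 2 <= dot x x * dot y y.
Proof.
have [/eqP|y0] := eqVneq (dot y y) 0.
  by rewrite dot_eq0 => /eqP ->; rewrite !dotv0 mulr0 expr0n.
have yp : 0 < dot y y by rewrite lt_neqAle eq_sym y0 dot_ge0.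
have := dot_ge0 (dot y y *: x - dot x y *: y).
rewrite !(dotBl, dotBr, dotZl, dotZr) (dotC y x).
rewrite (_ : _ - _ = dot y y * (dot x x * dot y y - dot x y ^+ 2)); last by ring.
by rewrite pmulr_rge0// subr_ge0.
Qed.

Lemma dot_le_enorm x y : `|dot x y| <= enorm x * enorm y.
Proof.
rewrite -ler_sqr ?nnegrE ?mulr_ge0 ?enorm_ge0// real_normK ?num_real//.
by rewrite exprMn !sqr_enorm sqr_dot_le.
Qed.

End DotProduct.

Lemma dot_mulmxl (R : realType) (m n : nat) (A : 'M[R]_(m, n)) x y :
  dot (A *m x) y = dot x (A^T *m y).
Proof. by rewrite /dot trmx_mul mulmxA. Qed.

Lemma cvg_sumr (R : realType) (T : Type) (F : set_system T) {FF : Filter F}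
    (I : finType) (f : T -> I -> R) (l : I -> R) :
  (forall i, f z i @[z --> F] --> l i) ->
  \sum_i f z i @[z --> F] --> \sum_i l i.
Proof.
move=> h; elim: (index_enum I) => [|i s IH].
  by under eq_cvg do rewrite big_nil; rewrite big_nil; apply: cvg_cst.
by under eq_cvg do rewrite big_cons; rewrite big_cons; apply: cvgD.
Qed.

Section IntegerVectors.
Context (R : realType) (n : nat).

Definition intvec (q : 'cV[int]_n) : 'cV[R]_n := map_mx intr q.

Let cvg_floor (x : R) :
  (Num.floor (k.+1%:R * x))%:~R / k.+1%:R @[k --> \oo] --> x.
Proof.
apply/cvgrPdist_le => e e0; near=> k.
have k0 : 0 < k.+1%:R :> R by rewrite ltr0n.
have ke : k.+1%:R^-1 <= e.
  by apply: ltW; near: k; exact: near_infty_natSinv_lt (PosNum e0).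
apply: le_trans ke; rewrite -(ler_pM2r k0) mulVf ?gt_eqF//.
rewrite -[X in _ * X <= _](gtr0_norm k0) -normrM mulrBl divfK ?gt_eqF//.
rewrite (mulrC x); have /andP[] := floor_itv (k.+1%:R * x).
move: (k.+1%:R * x) (Num.floor _) => y f h1 h2.
rewrite ger0_norm ?subr_ge0//; move: h2; rewrite intrD; lra.
Unshelve. all: by end_near. Qed.

(** By homogeneity a quadratic form is also nonnegative on rational vectors,
    and these are dense. *)
Lemma quadratic_form_ge0 (M : 'M[R]_n) :
  (forall q, 0 <= dot (intvec q) (M *m intvec q)) ->
  forall x, 0 <= dot x (M *m x).
Proof.
move=> M0 x.
have E y : dot y (M *m y) = \sum_i y i 0 * \sum_j M i j * y j 0.
  by rewrite dotE; apply: eq_bigr => i _; rewrite mxE.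
pose q k : 'cV[int]_n := \col_i Num.floor (k.+1%:R * x i 0).
pose y k : 'cV[R]_n := k.+1%:R^-1 *: intvec (q k).
have cy i : y k i 0 @[k --> \oo] --> x i 0.
  by under eq_cvg do rewrite !mxE mulrC; exact: cvg_floor.
have c : dot (y k) (M *m y k) @[k --> \oo] --> dot x (M *m x).
  rewrite E; under eq_cvg do rewrite E.
  apply: cvg_sumr => i; apply: cvgM => //; apply: cvg_sumr => j.
  by apply: cvgM => //; exact: cvg_cst.
rewrite -(cvg_lim (@Rhausdorff R) c); apply: limr_ge.
  by apply/cvg_ex; eexists; exact: c.
apply: nearW => k; rewrite /y -scalemxAr dotZl dotZr.
by rewrite !mulr_ge0// invr_ge0.
Qed.

End IntegerVectors.

(** * The top eigenvector as a maximiser *)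
Section Rayleigh.
Context (R : realType) (n : nat).

Let continuous_form (M : 'M[R]_n) :
  continuous (fun y : 'rV[R]_n => dot y^T (M *m y^T)).
Proof.
rewrite (_ : (fun _ => _) = fun z : 'rV[R]_n =>
    \sum_i z 0 i * \sum_j M i j * z 0 j); last first.
  apply/funext => z; rewrite dotE; apply: eq_bigr => i _; rewrite !mxE.
  by congr (_ * _); apply: eq_bigr => j _; rewrite !mxE.
move=> y.
have Fy := nbhs_filter y.
apply: (@cvg_sumr R _ (nbhs y) Fy) => i; apply: (@cvgM _ _ (nbhs y) Fy).
  exact: coord_continuous.
apply: (@cvg_sumr R _ (nbhs y) Fy) => j; apply: (@cvgM _ _ (nbhs y) Fy).
  exact: (@cvg_cst _ _ _ _ Fy).
exact: coord_continuous.
Qed.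

(** The largest eigenvalue bounds the quadratic form.  The form attains its maximum
    M on the unit sphere, by compactness.  The form of M - S is nonnegative and
    vanishes at a maximiser c, which forces (M - S) c = 0; so M is an eigenvalue
    and does not exceed the largest one. *)
Lemma unit_top_eigenvector_max (S : 'M[R]_n) (v x : 'cV[R]_n) :
  S^T = S -> unit_top_eigenvector S v ->
  dot x (S *m x) <= dot v (S *m v) * dot x x.
Proof.
move=> symS [v1 [a [_ amax Sv]]].
have vv : dot v v = 1 by rewrite -sqr_enorm v1 expr1n.
have -> : dot v (S *m v) = a by rewrite Sv dotZr vv mulr1.
pose N (y : 'rV[R]_n) := dot y^T (1%:M *m y^T).
pose K := [set y : 'rV[R]_n | N y = 1].
have cK : compact K.
  apply: (@subclosed_compact _ _
    [set y : 'rV[R]_n | forall i, `[-1, 1]%classic (y ord0 i)]).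
  - rewrite (_ : K = N @^-1` [set y | y = 1])//.
    apply: closed_comp; first by move=> y _; exact: continuous_form.
    exact: closed_eq.
  - by apply: (rV_compact (fun=> @segment_compact R (-1) 1)).
  - move=> y; rewrite /K /N /= mul1mx dotE => y1 i.
    rewrite in_itv/= -ler_norml -(@expr_le1 _ 2)// real_normK ?num_real//.
    rewrite -y1 (bigD1 i)//= !mxE expr2 lerDl.
    by apply: sumr_ge0 => j _; rewrite -expr2 sqr_ge0.
have K0 : K !=set0 by exists v^T; rewrite /K /N /= trmxK mul1mx.
have [c Kc cmax] := compact_EVT_max K0 cK
  (continuous_subspaceT (@continuous_form S)).
set M := dot c^T (S *m c^T) in cmax.
have bound z : dot z (S *m z) <= M * dot z z.
  have [->|z0] := eqVneq z 0; first by rewrite mulmx0 !dotv0 mulr0.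
  have zz : 0 < dot z z by rewrite lt_neqAle eq_sym dot_eq0 z0 dot_ge0.
  have e0 : enorm z != 0 by rewrite -sqrf_eq0 sqr_enorm gt_eqF.
  have := cmax ((enorm z)^-1 *: z)^T; rewrite trmxK -scalemxAr dotZl dotZr.
  rewrite mulrA -expr2 exprVn sqr_enorm mulrC ler_pdivrMr//; apply.
  rewrite inE /K /N /= trmxK mul1mx dotZl dotZr mulrA -expr2 exprVn sqr_enorm.
  by rewrite mulVf ?gt_eqF.
have cc : dot c^T c^T = 1 by move: Kc; rewrite inE /K /N /= mul1mx.
have Sc : S *m c^T = M *: c^T.
  pose B (z : 'cV[R]_n) : 'cV[R]_n := M *: z - S *m z.
  have BD z y : B (z + y) = B z + B y.
    by rewrite /B scalerDr mulmxDr opprD addrACA.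
  have BZ k z : B (k *: z) = k *: B z.
    by rewrite /B -scalemxAr scalerBr !scalerA mulrC.
  have B0 z : 0 <= dot z (B z) by rewrite /B dotBr dotZr subr_ge0.
  have Bsym z y : dot z (B y) = dot y (B z).
    rewrite /B !dotBr !dotZr (dotC z y); congr (_ - _).
    by rewrite -{1}symS -dot_mulmxl dotC.
  have Bc : dot c^T (B c^T) = 0 by rewrite /B dotBr dotZr cc mulr1 subrr.
  (* Otherwise the form would be negative at c - k y, for y = (M - S) c and this
     small positive k. *)
  pose y := B c^T; have Bc0 : dot y y = 0.
    apply/eqP; rewrite eq_le dot_ge0 andbT leNgt; apply/negP => yy.
    pose k := dot y y / (dot y (B y) + 1).
    have d0 : 0 < dot y (B y) + 1 by rewrite ltr_wpDl.
    have := B0 (c^T - k *: y).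
    rewrite -scaleNr BD BZ dotDl (dotDr c^T (B c^T)) (dotDr (- k *: y) (B c^T)).
    rewrite Bc add0r !dotZl !dotZr (Bsym c^T).
    rewrite -/y => h.
    have k0 : 0 < k by rewrite divr_gt0.
    have kd : k * (dot y (B y) + 1) = dot y y by rewrite divfK// gt_eqF.
    have : 0 <= k * (- 2 * dot y y + k * dot y (B y)).
      by apply: le_trans h _; rewrite le_eqVlt; apply/orP; left; apply/eqP; ring.
    rewrite pmulr_rge0// leNgt => /negP; apply.
    have := B0 y; move: kd; rewrite mulrDr mulr1; lra.
  by apply/esym/eqP; rewrite -subr_eq0; move/eqP: Bc0; rewrite dot_eq0.
have eM : eigenvalue S M.
  apply/eigenvalueP; exists c.
    by apply: trmx_inj; rewrite trmx_mul symS Sc linearZ.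
  apply/eqP => c0; move: cc; rewrite c0 trmx0 dotv0 => /eqP.
  by rewrite eq_sym oner_eq0.
by apply: le_trans (bound x) _; rewrite ler_wpM2r ?dot_ge0// amax.
Qed.

End Rayleigh.

(** * The signal seen by the top eigenvector *)
Section SmallBall.
Context (R : realType) (n m : nat) d (T : measurableType d).
Variables (P : probability T R).
Variables (z v : T -> 'cV[R]_n) (A : T -> 'M[R]_(m, n)) (s tau : R).
Hypotheses (s0 : 0 < s) (tau0 : 0 < tau).
Hypothesis mz : forall j, measurable_fun setT (fun w => z w j 0).
Hypothesis mv : forall j, measurable_fun setT (fun w => v w j 0).
Hypothesis mA : forall i j, measurable_fun setT (fun w => A w i j).
Let J := ('I_m * 'I_n)%type.
Let H (p : J) (w : T) := A w p.1 p.2.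
Hypothesis cos_zA : forall (q : 'cV[R]_n) b0 (b : J -> R) c,
  \int[P]_w cos (b0 * dot q (z w) + \sum_p b p * A w p.1 p.2 + c) =
  expR (- (s ^+ 2 * dot q q * b0 ^+ 2 / 2)) *
  \int[P]_w cos (\sum_p b p * A w p.1 p.2 + c).
Hypothesis v1 : forall w, dot (v w) (v w) = 1.
Let G w (x : 'cV[R]_n) := dot (A w *m x) (A w *m x).
Hypothesis vmax : forall w x, dot x (z w) ^+ 2 + G w x <=
  (dot (v w) (z w) ^+ 2 + G w (v w)) * dot x x.

Let x k : 'cV[R]_n := intvec R (odflt 0 (unpickle k)).

(** Almost maximality of |A x|^2 / |x|^2 at x k, with denominators cleared.
    Comparing with integer vectors only makes it a countable intersection of
    events determined by A. *)
Let E k : set T := if x k == 0 then set0 else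
  \bigcap_l [set w | 0 <= (G w (x k) + tau ^+ 2 * dot (x k) (x k)) *
                          dot (x l) (x l) - G w (x l) * dot (x k) (x k)].

Let measurable_ge d' (T' : measurableType d') (f : T' -> R) :
  measurable_fun setT f -> measurable [set w | 0 <= f w].
Proof.
move=> mf; have := mf measurableT _ (measurable_itv `[0, +oo[).
by rewrite setTI set_itvcy.
Qed.

Let sigma_E k : <<s orthants H >> (E k).
Proof.
rewrite /E; case: ifP => _; first exact: (@measurable0 _ (g_sigma_algebraType (orthants H))).
apply: (@bigcapT_measurable _ (g_sigma_algebraType (orthants H))) => l.
have mG (y : 'cV[R]_n) : measurable_fun setT
    (fun w : g_sigma_algebraType (orthants H) => G w y).
  have mAy i : measurable_fun setT
      (fun w : g_sigma_algebraType (orthants H) => (A w *m y) i 0).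
    rewrite (_ : (fun w => _) = fun w => \sum_j H (i, j) w * y j 0).
      apply: measurable_sum => j; apply: measurable_funM => //.
      exact: measurable_orthants_coord.
    by apply/funext => w; rewrite mxE.
  exact: measurable_dot.
apply: (@measurable_ge _ (g_sigma_algebraType (orthants H))).
by apply: measurable_funB; apply: measurable_funM => //; exact: measurable_funD.
Qed.

(** The supremum of |A x|^2 / |x|^2 over the integer vectors is finite, and is
    approached up to tau^2. *)
Let cover_E w : exists k, E k w.
Proof.
pose S := [set r | exists l, x l != 0 /\ r = G w (x l) / dot (x l) (x l)].
pose C := dot (v w) (z w) ^+ 2 + G w (v w).
have xx l : x l != 0 -> 0 < dot (x l) (x l).
  by move=> h; rewrite lt_neqAle eq_sym dot_eq0 h dot_ge0.
have supS : has_sup S.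
  split.
    have [j vj] : exists j, v w j 0 != 0.
      apply/not_existsP => h; have := v1 w; rewrite dotE big1 => [/eqP|j _].
        by rewrite eq_sym oner_eq0.
      by have /negP := h j; rewrite negbK => /eqP ->; rewrite mul0r.
    pose q : 'cV[int]_n := \col_i 1.
    exists (G w (x (pickle q)) / dot (x (pickle q)) (x (pickle q))).
    exists (pickle q); split => //; rewrite /x pickleK /=.
    apply/eqP => /matrixP/(_ j 0); rewrite !mxE => /eqP.
    by rewrite oner_eq0.
  exists C => _ [l [x0 ->]]; rewrite ler_pdivrMr ?xx//.
  by apply: le_trans (vmax w (x l)); rewrite lerDr sqr_ge0.
have [_ [k [xk ->]] hk] := sup_adherent (exprn_gt0 2 tau0) supS.
exists k; rewrite /E (negbTE xk) => l _ /=.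
have [->|xl] := eqVneq (x l) 0.
  by rewrite /G mulmx0 !dotv0 mulr0 mul0r subrr.
rewrite subr_ge0.
have h : G w (x l) / dot (x l) (x l) <= G w (x k) / dot (x k) (x k) + tau ^+ 2.
  rewrite -lerBlDr (le_trans _ (ltW hk))// lerB//.
  by apply: ub_le_sup; [case: supS|exists l].
move: h; rewrite ler_pdivrMr ?xx// => h.
have := ler_wpM2r (ltW (xx _ xk)) h; rewrite mulrAC mulrDl divfK ?gt_eqF ?xx//.
Qed.

(** The almost maximality of x k extends to the real vector v, by
    [quadratic_form_ge0].  With the maximality of v for (z.x)^2 + |A x|^2 it
    gives (z.(x k))^2 <= ((z.v)^2 + tau^2) |x k|^2. *)
Let small_inner_on_E w k : E k w -> `|dot (v w) (z w)| < tau ->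
  [/\ x k != 0 & `|dot (x k) (z w)| <= 2 * tau * enorm (x k)].
Proof.
rewrite /E; case: eqVneq => // xk hE vz; split => //.
pose c := G w (x k) + tau ^+ 2 * dot (x k) (x k).
pose M : 'M[R]_n := c%:M - dot (x k) (x k) *: ((A w)^T *m A w).
have ME y : dot y (M *m y) = c * dot y y - G w y * dot (x k) (x k).
  rewrite /M mulmxBl dotBr mul_scalar_mx dotZr -scalemxAl dotZr -mulmxA.
  by rewrite -dot_mulmxl -/(G w y) (mulrC (G _ _)).
have Mq q : 0 <= dot (intvec R q) (M *m intvec R q).
  by rewrite ME; have := hE (pickle q) I; rewrite /= /x pickleK.
have := quadratic_form_ge0 Mq (v w); rewrite ME v1 mulr1 subr_ge0 => hv.
have := vmax w (x k); rewrite mulrDl => hx.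
have vz2 : dot (v w) (z w) ^+ 2 <= tau ^+ 2.
  rewrite -[X in X <= _]real_normK ?num_real// ler_sqr ?nnegrE ?(ltW tau0)//.
  exact: ltW.
have xx := dot_ge0 (x k).
have h : dot (x k) (z w) ^+ 2 <= 2 * (tau ^+ 2 * dot (x k) (x k)).
  have := ler_wpM2r xx vz2; move: hx hv; rewrite /c.
  move: (dot (v w) (z w) ^+ 2 * _) (G w (v w) * _) (tau ^+ 2 * _) => a1 a2 a3.
  lra.
rewrite -ler_sqr ?nnegrE ?mulr_ge0 ?enorm_ge0 ?(ltW tau0)// real_normK ?num_real//.
rewrite !exprMn sqr_enorm; apply: (le_trans h).
by move: (mulr_ge0 (sqr_ge0 tau) xx); lra.
Qed.

(** On the part of E k outside the earlier events, |z.v| < tau forces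
    |z.(x k)| <= 2 tau |x k|, where z.(x k) is a Gaussian variable of standard
    deviation s |x k| independent of that part.  The bounds add up to 6 tau / s
    because these parts are disjoint. *)
Lemma small_ball :
  (P [set w | (`|dot (v w) (z w)| < tau)%R] <= (6 * tau / s)%:E)%E.
Proof.
pose F := [set w | `|dot (v w) (z w)| < tau].
have mF : measurable F.
  have mvz : measurable_fun setT (fun w => - `|dot (v w) (z w)|).
    by apply: measurable_funN; apply: measurableT_comp => //; exact: measurable_dot.
  rewrite (_ : F = [set w | - tau < - `|dot (v w) (z w)|]).
    exact: measurable_gt.
  by apply/seteqP; split => w /=; rewrite ltrN2.
have mH p : measurable_fun setT (H p) by exact: mA.
pose D k := seqDU E k.
have sD k : <<s orthants H >> (D k).
  apply: (@measurableD _ (g_sigma_algebraType (orthants H))); first exact: sigma_E.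
  by apply: (@bigsetU_measurable _ (g_sigma_algebraType (orthants H))) => i _; exact: sigma_E.
have mD k : measurable (D k).
  have sub : <<s orthants H >> `<=` measurable.
    apply: smallest_sub; first exact: sigma_algebra_measurable.
    exact: measurable_orthants.
  exact: sub (sD k).
have bound k : (P (F `&` D k) <= (6 * tau / s)%:E * P (D k))%E.
  have [xk|xk] := eqVneq (x k) 0.
    have -> : D k = set0.
      by rewrite -subset0 => w; rewrite /D /seqDU /E xk eqxx => -[].
    by rewrite setI0 measure0 mule0.
  have e0 : 0 < enorm (x k).
    by rewrite lt_neqAle enorm_ge0 andbT eq_sym -sqrf_eq0 sqr_enorm dot_eq0.
  have sx : 0 < s * enorm (x k) by rewrite mulr_gt0.
  have mY : measurable_fun setT (fun w => dot (x k) (z w)).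
    exact: measurable_dot.
  have t0 : 0 < 2 * tau * enorm (x k) by rewrite !mulr_gt0.
  have := @gaussian_anticoncentration _ _ _ P _ sx J _ H mY mH _ (D k) _ t0 (sD k).
  rewrite (_ : 3 * (2 * tau * enorm (x k)) / (s * enorm (x k)) = 6 * tau / s); last first.
    by field; rewrite !gt_eqF.
  move=> h; apply: le_trans (h _).
    apply: le_measure; rewrite ?inE.
    - exact: measurableI.
    - apply: measurableI => //.
      rewrite (_ : [set w | _] = ~` [set w | 2 * tau * enorm (x k) < `|dot (x k) (z w)|]).
        by apply: measurableC; apply: measurable_gt; exact: measurableT_comp.
      by apply/seteqP; split => w /=; rewrite leNgt => /negP.
    - move=> w [Fw Dw]; split => //=.
      by have [_] := small_inner_on_E (subset_seqDU Dw) Fw.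
  by move=> b0 b c; rewrite cos_zA exprMn sqr_enorm.
have FE : F `<=` \bigcup_k (F `&` D k).
  move=> w Fw; have [k Ek] := cover_E w.
  have : (\bigcup_k E k) w by exists k.
  by rewrite seqDU_bigcup_eq => -[l _ Dl]; exists l.
apply: (@le_trans _ _ (\sum_(k <oo) P (F `&` D k))%E).
  apply: measure_sigma_subadditive => //.
  by move=> k; exact: measurableI.
apply: (@le_trans _ _ (\sum_(k <oo) (6 * tau / s)%:E * P (D k))%E).
  by apply: lee_nneseries => // k _; exact: bound.
rewrite nneseriesZl// -[leRHS]mule1 lee_wpmul2l//.
  by rewrite lee_fin divr_ge0 ?mulr_ge0 ?ltW.
have <- : P (\bigcup_k D k) = (\sum_(k <oo) P (D k))%E.
  rewrite measure_semi_bigcup//; first exact: trivIset_seqDU.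
  exact: bigcupT_measurable.
by apply: probability_le1; exact: bigcupT_measurable.
Qed.

End SmallBall.

(** * Thresholding a perturbed sparse vector *)
Section Threshold.
Context (R : realType) (d : nat).
Implicit Types (u E y : 'cV[R]_d).

Lemma enormD_le y u : enorm (y + u) <= enorm y + enorm u.
Proof.
rewrite -ler_sqr ?nnegrE ?addr_ge0 ?enorm_ge0// sqrrD !sqr_enorm.
rewrite dotDl !dotDr (dotC u y) mulr2n.
have := le_trans (ler_norm _) (dot_le_enorm y u).
move: (dot y u) (enorm y * enorm u) (dot y y) (dot u u) => a b e f; lra.
Qed.

Lemma enormZ a u : enorm (a *: u) = `|a| * enorm u.
Proof.
by rewrite /enorm dotZl dotZr mulrA -expr2 sqrtrM ?sqr_ge0// sqrtr_sqr.
Qed.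

(** Off the support of u the vector is pure noise and is set to zero; on the support
    it survives, since K > 2.  So the thresholded vector is a u + f with
    |f_i| <= |a u_i| / K for all i, hence |f| <= |a| / K. *)
Lemma hard_threshold_angle u E (a t K : R) :
  dot u u = 1 -> 0 < t -> 2 < K ->
  (forall i, `|E i 0| <= t) ->
  (forall i, u i 0 != 0 -> K * t <= `|a| * `|u i 0|) ->
  (K - 1) / (K + 1) <= `|dot (normalize (hard_threshold t (a *: u + E))) u|.
Proof.
move=> u1 t0 K2 Et Ku; set y := hard_threshold t _.
pose f := y - a *: u.
have fK i : K * `|f i 0| <= `|a| * `|u i 0|.
  rewrite /f /y !mxE; have [ui0|ui0] := eqVneq (u i 0) 0.
    by rewrite ui0 mulr0 add0r ifF ?subrr ?normr0 ?mulr0// ltNge Et.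
  have h := Ku i ui0; rewrite ifT.
    rewrite addrAC subrr add0r (le_trans _ h)// ler_wpM2l ?Et//; lra.
  rewrite (lt_le_trans _ (lerB_normD _ _))// normrM.
  by have := Et i; nra.
have eu : enorm u = 1 by rewrite /enorm u1 sqrtr1.
have a0 : 0 < `|a|.
  rewrite normr_gt0; apply/eqP => a0.
  have /eqP : u = 0.
    apply/matrixP => i j; rewrite ord1 mxE; apply/eqP/negPn/negP => ui0.
    by have := Ku i ui0; rewrite a0 normr0 mul0r; apply/negP; rewrite -ltNge mulr_gt0//; lra.
  by rewrite -dot_eq0 u1 oner_eq0.
have ef : K * enorm f <= `|a|.
  have K0 : 0 <= K by lra.
  rewrite -ler_sqr ?nnegrE ?mulr_ge0 ?enorm_ge0// exprMn sqr_enorm.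
  rewrite -[leRHS]mulr1 -u1 !dotE !mulr_sumr; apply: ler_sum => i _.
  rewrite -!expr2 -(real_normK (num_real (f i 0))).
  rewrite -[X in _ <= _ * X](real_normK (num_real (u i 0))) -!exprMn.
  by rewrite ler_sqr ?nnegrE ?mulr_ge0.
have yE : y = a *: u + f by rewrite /f addrC subrK.
have ny : enorm y <= `|a| + enorm f.
  by rewrite yE (le_trans (enormD_le _ _))// enormZ eu mulr1.
have dy : `|a| - enorm f <= `|dot y u|.
  rewrite yE dotDl dotZl u1 mulr1 (le_trans _ (lerB_normD _ _))// lerB//.
  by rewrite (le_trans (dot_le_enorm _ _))// eu mulr1.
have ey : 0 < enorm y.
  have := dot_le_enorm y u; rewrite eu mulr1 => h.
  by apply: lt_le_trans h; apply: lt_le_trans dy; have := enorm_ge0 f; nra.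
rewrite /normalize dotZl normrM ger0_norm ?invr_ge0 ?enorm_ge0// [leRHS]mulrC.
rewrite ler_pdivlMr// mulrAC ler_pdivrMr; last by lra.
have := enorm_ge0 f; move: ef ny dy a0 ey.
move: (enorm f) (enorm y) (`|a|) (`|dot y u|) => e n a' b.
move=> h1 h2 h3 a0 n0 e0.
have h4 : (K - 1) * n <= (K - 1) * (a' + e) by rewrite ler_wpM2l//; lra.
have h5 : (K + 1) * (a' - e) <= b * (K + 1) by rewrite mulrC ler_wpM2r//; lra.
apply: le_trans h4 (le_trans _ h5); nra.
Qed.

Lemma normalize_dot_le1 y u : dot u u = 1 -> `|dot (normalize y) u| <= 1.
Proof.
move=> u1; rewrite (le_trans (dot_le_enorm _ _))//.
rewrite {2}/enorm u1 sqrtr1 mulr1 /normalize enormZ ger0_norm ?invr_ge0 ?enorm_ge0//.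
have [->|e0] := eqVneq (enorm y) 0; first by rewrite mulr0.
by rewrite mulVf.
Qed.

End Threshold.

(** * The bound in a fixed dimension *)
Lemma measure_bigsetU_le d (T : measurableType d) (R : realType)
    (mu : {measure set T -> \bar R}) (I : Type) (s : seq I) (F : I -> set T) :
  (forall i, measurable (F i)) ->
  (mu (\big[setU/set0]_(i <- s) F i) <= \sum_(i <- s) mu (F i))%E.
Proof.
move=> mF; elim: s => [|i s IH]; first by rewrite !big_nil measure0.
rewrite !big_cons; apply: le_trans (measureU2 _ _ _) _ => //.
  exact: bigsetU_measurable.
by apply: leeD.
Qed.

Section Spectrum.
Context (R : realType) (d : nat) (Sigma : 'M[R]_d).
Variables (u : nat -> 'cV[R]_d) (lam : nat -> R) (L : R).
Hypothesis hu : forall i j, (1 <= i <= d)%N -> (1 <= j <= d)%N ->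
  dot (u i) (u j) = (i == j)%:R.
Hypothesis heig : forall i, (1 <= i <= d)%N -> Sigma *m u i = lam i *: u i.
Hypothesis lamL : forall i, (2 <= i <= d)%N -> lam i <= L.

(** Expand x in the orthonormal basis of eigenvectors: the coordinate on u 1
    vanishes and the other eigenvalues are at most L. *)
Lemma orthogonal_form_le (x : 'cV[R]_d) : (0 < d)%N -> dot (u 1%N) x = 0 ->
  dot x (Sigma *m x) <= L * dot x x.
Proof.
move=> d0 ux.
pose U : 'M[R]_d := \matrix_(i, k) u k.+1 i 0.
have ord_in (k : 'I_d) : (1 <= k.+1 <= d)%N by rewrite /= ltn_ord.
have UU : U^T *m U = 1%:M.
  apply/matrixP => k l; rewrite !mxE.
  have := hu (ord_in k) (ord_in l); rewrite dotE eqSS -val_eqE => <-.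
  by apply: eq_bigr => i _; rewrite !mxE.
pose c := U^T *m x.
have xE : x = U *m c by rewrite /c mulmxA (mulmx1C UU) mul1mx.
have cE k : c k 0 = dot (u k.+1) x.
  by rewrite mxE dotE; apply: eq_bigr => i _; rewrite !mxE.
pose D : 'M[R]_d := diag_mx (\row_k lam k.+1).
have SU : Sigma *m U = U *m D.
  apply/matrixP => i k; rewrite mul_mx_diag !mxE.
  have /matrixP/(_ i 0) := heig (ord_in k); rewrite !mxE => h.
  rewrite [RHS]mulrC -h.
  by apply: eq_bigr => j _; rewrite !mxE.
have UdotE y y' : dot (U *m y) (U *m y') = dot y y' :> R.
  by rewrite dot_mulmxl mulmxA UU mul1mx.
have DE (y : 'cV[R]_d) k : (D *m y) k 0 = lam k.+1 * y k 0.
  by rewrite mul_diag_mx !mxE.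
rewrite xE mulmxA SU -mulmxA !UdotE !dotE mulr_sumr; apply: ler_sum => k _.
rewrite DE mulrCA.
have [k0|k0] := posnP k.
  have -> : c k 0 = 0 by rewrite cE k0 ux.
  by rewrite !mulr0.
by rewrite ler_wpM2r -?expr2 ?sqr_ge0// lamL// ltn_ord andbT ltnS.
Qed.

End Spectrum.

Section FixedDimension.
Context (R : realType) (d n : nat) (d0 : (0 < d)%N) (n0 : (0 < n)%N).
Context (disp : measure_display) (T : measurableType disp).
Variables (P : probability T R) (X : 'I_n -> T -> 'cV[R]_d) (Sigma : 'M[R]_d).
Hypothesis hX : iid_mvnormal P X 0 Sigma.
Variables (u : nat -> 'cV[R]_d) (lam : nat -> R) (L : R) (L0 : 0 < L).
Hypothesis hu : forall i j, (1 <= i <= d)%N -> (1 <= j <= d)%N ->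
  dot (u i) (u j) = (i == j)%:R.
Hypothesis heig : forall i, (1 <= i <= d)%N -> Sigma *m u i = lam i *: u i.
Hypothesis lam1 : 0 < lam 1%N.
Hypothesis lamL : forall i, (2 <= i <= d)%N -> lam i <= L.
Variables (t K tau : R) (t0 : 0 < t) (K2 : 2 < K) (tau0 : 0 < tau).
Hypothesis htau : forall i, u 1%N i 0 != 0 -> K * t <= tau * `|u 1%N i 0|.
Variable v : T -> 'cV[R]_n.
Hypothesis mv : random_vector v.
Hypothesis hv : forall w,
  unit_top_eigenvector (dual_sample_cov (data_matrix X w)) (v w).

Let u1 := u 1%N.
Let u1u1 : dot u1 u1 = 1. Proof. by rewrite hu. Qed.
Let z w : 'cV[R]_n := \col_j dot u1 (X j w).
Let g (i : 'I_d) : 'cV[R]_d := delta_mx i 0 - u1 i 0 *: u1.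
(** The noise matrix; g i represents the i-th coordinate of the projection on the
    orthogonal complement of u1. *)
Let A w : 'M[R]_(d, n) := \matrix_(i, j) dot (g i) (X j w).

Let symS : Sigma^T = Sigma.
Proof. by have [_ /(_ (Ordinal n0))[]] := hX. Qed.
Let rX j : random_vector (X j).
Proof. by have [_ /(_ j)[]] := hX. Qed.

Let dot_delta i (x : 'cV[R]_d) : dot (delta_mx i 0) x = x i 0.
Proof.
rewrite dotE (bigD1 i)//= mxE !eqxx mul1r big1 ?addr0// => j ji.
by rewrite mxE (negbTE ji) mul0r.
Qed.

Let u1g i : dot u1 (g i) = 0.
Proof. by rewrite /g dotBr dotZr u1u1 mulr1 dotC dot_delta subrr. Qed.

Let sqr_g_le1 i : dot (g i) (g i) <= 1.
Proof.
rewrite {1}/g dotBl dotZl u1g mulr0 subr0 dot_delta !mxE !eqxx/=.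
by rewrite lerBlDr lerDl -expr2 sqr_ge0.
Qed.

Let dataE w : data_matrix X w = u1 *m (z w)^T + A w.
Proof.
apply/matrixP => i j; rewrite !mxE big_ord1 !mxE /g dotBl dot_delta dotZl.
by rewrite addrC subrK.
Qed.

Let data_mulE w x : data_matrix X w *m x = dot (z w) x *: u1 + A w *m x.
Proof.
rewrite dataE mulmxDl -mulmxA; congr (_ + _).
by apply/matrixP => i j; rewrite ord1 [LHS]mxE big_ord1 [RHS]mxE mulrC.
Qed.

Let u1A w x : dot u1 (A w *m x) = 0.
Proof.
rewrite dotC dot_mulmxl dotE big1// => j _.
rewrite [X in _ * X](_ : _ = 0) ?mulr0// mxE.
rewrite (_ : (\sum_i _) = dot (\sum_i u1 i 0 *: g i) (X j w)).
  have -> : \sum_i u1 i 0 *: g i = 0.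
    rewrite /g; under eq_bigr do rewrite scalerBr scalerA.
    rewrite sumrB -scaler_suml (_ : \sum_i u1 i 0 * u1 i 0 = 1) ?scale1r.
      apply/eqP; rewrite subr_eq0; apply/eqP/matrixP => k l; rewrite ord1.
      rewrite summxE (bigD1 k)//= !mxE !eqxx mulr1 big1 ?addr0// => i ik.
      by rewrite !mxE eq_sym (negbTE ik) mulr0.
    by rewrite -u1u1 dotE.
  by rewrite dot0v.
rewrite dot_suml; apply: eq_bigr => i _.
by rewrite dotZl !mxE mulrC.
Qed.

Let sqr_data w x : dot (data_matrix X w *m x) (data_matrix X w *m x) =
  dot x (z w) ^+ 2 + dot (A w *m x) (A w *m x).
Proof.
rewrite data_mulE dotDl !dotDr !dotZl !dotZr u1u1 u1A (dotC _ u1) u1A.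
by rewrite (dotC x); ring.
Qed.

Let v1 w : dot (v w) (v w) = 1.
Proof. by have [h _] := hv w; rewrite -sqr_enorm h expr1n. Qed.

Let vmax w x : dot x (z w) ^+ 2 + dot (A w *m x) (A w *m x) <=
  (dot (v w) (z w) ^+ 2 + dot (A w *m v w) (A w *m v w)) * dot x x.
Proof.
rewrite -!sqr_data.
have SE y : dot y (dual_sample_cov (data_matrix X w) *m y) =
    n%:R^-1 * dot (data_matrix X w *m y) (data_matrix X w *m y).
  by rewrite /dual_sample_cov -scalemxAl dotZr -mulmxA -dot_mulmxl.
have symD : (dual_sample_cov (data_matrix X w))^T =
    dual_sample_cov (data_matrix X w).
  by rewrite /dual_sample_cov linearZ /= trmx_mul trmxK.
have := unit_top_eigenvector_max x symD (hv w).
by rewrite !SE -mulrA ler_pM2l// invr_gt0 ltr0n.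
Qed.

Let mcoord j i : measurable_fun setT (fun w => X j w i 0).
Proof. exact: measurable_coord. Qed.
Let mz j : measurable_fun setT (fun w => z w j 0).
Proof.
rewrite (_ : (fun w => _) = fun w => dot u1 (X j w)); first exact: measurable_dotl.
by apply/funext => w; rewrite mxE.
Qed.
Let mA i j : measurable_fun setT (fun w => A w i j).
Proof.
rewrite (_ : (fun w => _) = fun w => dot (g i) (X j w)); first exact: measurable_dotl.
by apply/funext => w; rewrite mxE.
Qed.
Let mvj j : measurable_fun setT (fun w => v w j 0).
Proof. exact: measurable_coord. Qed.

(** The mixed functional is a sum over j of inner products of X_j with
    b0 q_j u1 + r_j, where r_j is orthogonal to u1.  As u1 is an eigenvector,
    the variance has no cross term. *)
Let cos_zA (q : 'cV[R]_n) b0 (b : ('I_d * 'I_n)%type -> R) c :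
  \int[P]_w cos (b0 * dot q (z w) + \sum_p b p * A w p.1 p.2 + c) =
  expR (- (Num.sqrt (lam 1%N) ^+ 2 * dot q q * b0 ^+ 2 / 2)) *
  \int[P]_w cos (\sum_p b p * A w p.1 p.2 + c).
Proof.
pose r j := \sum_i b (i, j) *: g i.
have u1r j : dot u1 (r j) = 0.
  by rewrite dot_sumr big1// => i _; rewrite dotZr u1g mulr0.
have rE w : \sum_p b p * A w p.1 p.2 = \sum_j dot (r j) (X j w).
  rewrite (eq_bigr (fun p => b (p.1, p.2) * A w p.1 p.2)); last by case.
  rewrite -(pair_bigA _ (fun i j => b (i, j) * A w i j))/= exchange_big /=.
  apply: eq_bigr => j _; rewrite dot_suml; apply: eq_bigr => i _.
  by rewrite dotZl mxE.
have aE w : b0 * dot q (z w) + \sum_p b p * A w p.1 p.2 =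
    \sum_j dot ((b0 * q j 0) *: u1 + r j) (X j w).
  rewrite rE dotE mulr_sumr -big_split; apply: eq_bigr => j _ /=.
  by rewrite mxE dotDl dotZl mulrA.
under eq_Rintegral do rewrite aE.
under [in RHS]eq_Rintegral do rewrite rE.
rewrite !(Rintegral_iid_mvnormal_cos _ _ hX) mulrCA -expRD; congr (_ * expR _).
have Su : Sigma *m u1 = lam 1%N *: u1 by apply: heig; rewrite d0.
have form k (x : 'cV[R]_d) : dot u1 x = 0 ->
    dot (k *: u1 + x) (Sigma *m (k *: u1 + x)) =
    k ^+ 2 * lam 1%N + dot x (Sigma *m x).
  move=> ux; have uSx : dot u1 (Sigma *m x) = 0.
    by rewrite -{1}symS -dot_mulmxl Su dotZl ux mulr0.
  rewrite mulmxDr -scalemxAr Su dotDl !dotDr !dotZl !dotZr u1u1 uSx (dotC x) ux.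
  by ring.
rewrite (eq_bigr (fun j => (b0 * q j 0) ^+ 2 * lam 1%N +
    dot (r j) (Sigma *m r j))); last by move=> j _; rewrite form.
rewrite big_split/= sqr_sqrtr ?(ltW lam1)// dotE -mulr_suml.
rewrite (eq_bigr (fun j => b0 ^+ 2 * (q j 0 * q j 0))); last first.
  by move=> j _; rewrite exprMn expr2.
by rewrite -mulr_sumr; ring.
Qed.

Let cos_angle_ge w : (forall i j, `|A w i j| <= t / n%:R) ->
  tau <= `|dot (v w) (z w)| ->
  (K - 1) / (K + 1) <=
  `|dot (st_estimator (data_matrix X w) (v w) t) u1|.
Proof.
move=> hA hz; rewrite /st_estimator data_mulE; apply: hard_threshold_angle => //.
  move=> i; rewrite mxE (le_trans (ler_norm_sum _ _ _))//.
  rewrite (_ : t = \sum_(j < n) t / n%:R); last first.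
    by rewrite sumr_const card_ord -[RHS]mulr_natr divfK// pnatr_eq0 -lt0n.
  apply: ler_sum => j _; rewrite normrM.
  have vj : `|v w j 0| <= 1.
    rewrite -(@expr_le1 _ 2)// real_normK ?num_real// -(v1 w) dotE (bigD1 j)//=.
    by rewrite expr2 lerDl; apply: sumr_ge0 => k _; rewrite -expr2 sqr_ge0.
  by rewrite -[leRHS]mulr1 ler_pM.
move=> i ui; apply: le_trans (htau ui) _.
by rewrite ler_wpM2r// dotC.
Qed.

Let large_noise_le : (P (\big[setU/set0]_i \big[setU/set0]_j
    [set w | (t / n%:R < `|A w i j|)%R]) <=
  (d%:R * n%:R * (2 * expR (- ((t / n%:R) ^+ 2 / (2 * L)))))%:E)%E.
Proof.
have mB i j : measurable [set w | t / n%:R < `|A w i j|].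
  by apply: measurable_gt; exact: measurableT_comp.
have tn : 0 <= t / n%:R by rewrite divr_ge0// ltW.
set B := 2 * _.
have PB i j : (P [set w | (t / n%:R < `|A w i j|)%R] <= B%:E)%E.
  rewrite (_ : [set w | _] = [set w | t / n%:R < `|dot (g i) (X j w)|]).
    have [_ /(_ j) hj] := hX.
    apply: mvnormal_tail_le hj _ L0 tn.
    apply: le_trans (orthogonal_form_le hu heig lamL d0 (u1g i)) _.
    by rewrite -[leRHS]mulr1 ler_pM2l.
  by apply/seteqP; split => w /=; rewrite mxE.
apply: le_trans (measure_bigsetU_le _ _ _) _.
  by move=> i; apply: bigsetU_measurable => j _.
apply: (@le_trans _ _ (\sum_(i < d) \sum_(j < n) B%:E)%E).
  apply: lee_sum => i _; apply: le_trans (measure_bigsetU_le _ _ _) _ => //.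
  by apply: lee_sum => j _; exact: PB.
under eq_bigr do rewrite sumEFin sumr_const card_ord.
by rewrite sumEFin sumr_const card_ord lee_fin -mulrnA -[leLHS]mulr_natl natrM (mulrC n%:R).
Qed.

Let y w := `|dot (st_estimator (data_matrix X w) (v w) t) u1|.

Let y01 w : 0 <= y w <= 1.
Proof. by rewrite normr_ge0 normalize_dot_le1. Qed.

Let measurable_y : measurable_fun setT y.
Proof.
have md i j : measurable_fun setT (fun w => data_matrix X w i j).
  under eq_fun do rewrite mxE; exact: mcoord.
have mh i : measurable_fun setT
    (fun w => (hard_threshold t (data_matrix X w *m v w)) i 0).
  under eq_fun do rewrite mxE.
  have mp : measurable_fun setT (fun w => (data_matrix X w *m v w) i 0).
    under eq_fun do rewrite mxE.
    by apply: measurable_sum => j; exact: measurable_funM.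
  apply: measurable_fun_ifT => //.
  by apply: measurable_fun_ltr => //; exact: measurableT_comp.
apply: measurableT_comp => //; apply: measurable_dot => i; last exact: measurable_cst.
under eq_fun do rewrite mxE.
apply: measurable_funM => //.
have me : measurable_fun setT
    (fun w => enorm (hard_threshold t (data_matrix X w *m v w))).
  apply: (measurableT_comp (f := @Num.sqrt R)).
    by apply: continuous_measurable_fun; exact: sqrt_continuous.
  exact: measurable_dot.
under eq_fun do rewrite -powR_inv1 ?enorm_ge0//.
exact: (measurableT_comp (measurable_powR (-1)) me).
Qed.

(** By [hard_threshold_angle] the angle can be large only if an entry of the noise
    matrix is large or the coefficient z.v is small. *)
Lemma st_estimator_failure_le (eps : R) : 0 < eps < pi ->
  cos eps <= (K - 1) / (K + 1) ->
  (P [set w | (eps < `|acos (y w)|)%R] <=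
   (d%:R * n%:R * (2 * expR (- ((t / n%:R) ^+ 2 / (2 * L)))) +
    6 * tau / Num.sqrt (lam 1%N))%:E)%E.
Proof.
move=> /andP[e0 epi] eK.
have evE w : (eps < `|acos (y w)|) = (y w < cos eps).
  have /andP[ya yb] := y01 w.
  have y1 : -1 <= y w <= 1 by rewrite yb andbT; lra.
  rewrite ger0_norm ?acos_ge0// -{2}(@acosK R (y w)) ?in_itv//.
  by rewrite ltr_cos// in_itv/= ?acos_ge0 ?acos_lepi// !ltW.
have -> : [set w | eps < `|acos (y w)|] = [set w | y w < cos eps].
  by apply/seteqP; split => w /=; rewrite evE.
pose B1 := \big[setU/set0]_i \big[setU/set0]_j [set w | t / n%:R < `|A w i j|].
pose B2 := [set w | `|dot (v w) (z w)| < tau].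
have mB1 : measurable B1.
  apply: bigsetU_measurable => i _; apply: bigsetU_measurable => j _.
  by apply: measurable_gt; exact: measurableT_comp.
have mB2 : measurable B2.
  rewrite (_ : B2 = [set w | - tau < - `|dot (v w) (z w)|]).
    apply: measurable_gt; apply: measurable_funN; apply: measurableT_comp => //.
    exact: measurable_dot.
  by apply/seteqP; split => w /=; rewrite ltrN2.
have me : measurable [set w | y w < cos eps].
  rewrite (_ : [set w | _] = [set w | - cos eps < - y w]).
    by apply: measurable_gt; exact: measurable_funN.
  by apply/seteqP; split => w /=; rewrite ltrN2.
apply: (@le_trans _ _ (P (B1 `|` B2))).
  apply: le_measure; rewrite ?inE//; first exact: measurableU.
  move=> w /= yw; apply: contrapT => nB.
  have nB1 : ~ B1 w by move=> h; apply: nB; left.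
  have nB2 : ~ B2 w by move=> h; apply: nB; right.
  move: yw; apply/negP; rewrite -leNgt; apply: le_trans eK _; apply: cos_angle_ge.
    move=> i j; rewrite leNgt; apply/negP => h; apply: nB1.
    rewrite /B1 -bigcup_seq; exists i; first by rewrite /= mem_index_enum.
    by rewrite -bigcup_seq; exists j => //=; rewrite mem_index_enum.
  by rewrite leNgt; apply/negP.
apply: le_trans (measureU2 _ _ _) _ => //.
rewrite EFinD; apply: leeD; first exact: large_noise_le.
apply: (small_ball _ tau0 mz mvj mA cos_zA v1 vmax).
by rewrite sqrtr_gt0.
Qed.

End FixedDimension.

(** * Passing to the limit *)
Section Asymptotics.
Context (R : realType).

Lemma limn_esup_lt_near (f : nat -> \bar R) (c : \bar R) :
  (limn_esup f < c)%E -> \forall d \near \oo, (f d < c)%E.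
Proof.
rewrite /limn_esup /limf_esup => /ereal_inf_lt[_ [A oA <-] Ac].
near=> d; apply: le_lt_trans Ac; apply: ereal_sup_ubound.
by exists d => //; near: d.
Unshelve. all: by end_near. Qed.

Lemma limn_einf_gt_near (f : nat -> \bar R) (c : \bar R) :
  (c < limn_einf f)%E -> \forall d \near \oo, (c < f d)%E.
Proof.
rewrite /limn_einf lteNr => /limn_esup_lt_near.
by apply: filterS => d; rewrite lteN2.
Qed.

Lemma same_order_near (a b : nat -> R) : same_order a b ->
  (\forall d \near \oo, 0 < b d) ->
  exists c1 c2, [/\ 0 < c1, 0 < c2 &
    \forall d \near \oo, c1 * b d <= a d <= c2 * b d].
Proof.
move=> [c1 [c2 [c10 c12 h1 h2]]] b0; exists (c1 / 2), (c2 + 1).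
split; [by rewrite divr_gt0|by rewrite addr_gt0// (lt_le_trans c10)|].
have n1 : \forall d \near \oo, ((c1 / 2)%:E < (a d / b d)%:E)%E.
  by apply: limn_einf_gt_near; apply: lt_le_trans h1; rewrite lte_fin; lra.
have n2 : \forall d \near \oo, ((a d / b d)%:E < (c2 + 1)%:E)%E.
  by apply: limn_esup_lt_near; apply: le_lt_trans h2 _; rewrite lte_fin; lra.
near=> d; have bd : 0 < b d by near: d; exact: b0.
have /ltW : c1 / 2 < a d / b d by rewrite -lte_fin; near: d; exact: n1.
have /ltW : a d / b d < c2 + 1 by rewrite -lte_fin; near: d; exact: n2.
by rewrite ler_pdivrMr// ler_pdivlMr// => -> ->.
Unshelve. all: by end_near. Qed.

Lemma powR_nat_ge_near (e M : R) : 0 < e ->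
  \forall d \near \oo, M <= (d%:R : R) `^ e.
Proof.
move=> e0; pose M' := Num.max M 1.
have M0 : 0 <= M' by rewrite le_max ler01 orbT.
near=> d; apply: (@le_trans _ _ M'); first by rewrite le_max lexx.
have hd : M' `^ e^-1 <= d%:R.
  rewrite (le_trans (ltW (archi_boundP (powR_ge0 _ _))))// ler_nat.
  by near: d; exact: nbhs_infty_ge.
have -> : M' = (M' `^ e^-1) `^ e by rewrite -powRrM mulVf ?gt_eqF// powRr1.
by apply: ge0_ler_powR; rewrite ?nnegrE ?powR_ge0 ?ler0n// ltW.
Unshelve. all: by end_near. Qed.

Lemma powR_nat_cvg0 (e : R) : 0 < e ->
  (d%:R : R) `^ (- e) @[d --> \oo] --> (0 : R).
Proof.
move=> e0; apply/cvgr0Pnorm_le => r r0; near=> d.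
rewrite ger0_norm ?powR_ge0// powRN.
have h : r^-1 <= (d%:R : R) `^ e by near: d; exact: powR_nat_ge_near.
have dp : 0 < (d%:R : R) `^ e by apply: lt_le_trans h; rewrite invr_gt0.
by rewrite -[leRHS]invrK lef_pV2 ?posrE ?invr_gt0.
Unshelve. all: by end_near. Qed.

Lemma ln_nat_ge_near (M : R) : \forall d \near \oo, M <= ln (d%:R : R).
Proof.
near=> d; have hd : expR M <= d%:R.
  rewrite (le_trans (ltW (archi_boundP (expR_ge0 _))))// ler_nat.
  by near: d; exact: nbhs_infty_ge.
by rewrite -ler_expR lnK// posrE (lt_le_trans _ hd)// expR_gt0.
Unshelve. all: by end_near. Qed.

End Asymptotics.

(* lam d i and u d i are the i-th eigenvalue and eigenvector, with 1 <= i <= d;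
   the k-th coordinate of a vector has the ordinal of value k - 1. *)
Theorem theorem2p2 (R : realType) (n : nat) (hn : (1 <= n)%N)
  (beta : R) (hbeta : 0 <= beta <= 1)
  (disp : nat -> measure_display) (T : forall d, measurableType (disp d))
  (P : forall d, probability (T d) R)
  (X : forall d, 'I_n -> T d -> 'cV[R]_d)
  (Sigma : forall d, 'M[R]_d)
  (hX : forall d, iid_mvnormal (P d) (X d) 0 (Sigma d))
  (lam : nat -> nat -> R) (u : forall d, nat -> 'cV[R]_d)
  (hlam : forall d i j, (1 <= i <= j)%N -> (j <= d)%N -> lam d j <= lam d i)
  (hu : forall d i j, (1 <= i <= d)%N -> (1 <= j <= d)%N ->
     dot (u d i) (u d j) = (i == j)%:R)
  (heig : forall d i, (1 <= i <= d)%N -> Sigma d *m u d i = lam d i *: u d i)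
  (hsupp : forall d (i : 'I_d),
     (u d 1%N i 0 != 0) = (i < Num.truncn (d%:R `^ beta))%N)
  (* (a) *)
  (alpha theta : R)
  (halpha : 0 < alpha <= 1) (htheta : 0 <= theta < alpha)
  (ha1 : same_order (fun d => lam d 1%N) (fun d => d%:R `^ alpha))
  (ha2 : same_order (fun d => lam d 2%N) (fun d => d%:R `^ theta))
  (ha3 : same_order (fun d => \sum_(2 <= i < d.+1) lam d i) (fun d => d%:R))
  (* (b) *)
  (C : R) (hC : 0 <= C)
  (hb1 : limn_esup
     (fun d => (lam d 1%N / \sum_(2 <= i < d.+1) lam d i)%:E) = C%:E)
  (hb2 : (\sum_(1 <= i < d.+1) lam d i ^+ 2)
           / (\sum_(1 <= i < d.+1) lam d i) ^+ 2 @[d --> \oo] --> (0 : R))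
  (* (c) *)
  (eta : R) (heta : 0 <= eta < alpha)
  (hc : same_order
     (fun d => \big[Num.max/0]_(i < d | (i < Num.truncn (d%:R `^ beta))%N)
                 `|u d 1%N i 0|^-1)
     (fun d => d%:R `^ (eta / 2)))
  (* (d) *)
  (rho : nat -> R) (Delta : forall d, 'M[R]_d)
  (hd1 : forall d, iid_mvnormal (P d)
     (fun j w => \sum_(2 <= i < d.+1) dot (X d j w) (u d i) *: u d i)
     0 (Delta d))
  (hd2 : forall d (k l : 'I_d), k != l ->
     (k < Num.truncn (d%:R `^ beta))%N -> (l < Num.truncn (d%:R `^ beta))%N ->
     `|Delta d k l|
       <= Num.sqrt (Delta d k k) * Num.sqrt (Delta d l l) * rho `|k - l|%N)
  (hrho1 : forall t, (1 < t)%N -> rho t < 1)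
  (hrho2 : rho t * ln t%:R @[t --> \oo] --> (0 : R))
  (* (e) *)
  (lambda : nat -> R) (delta gamma : R)
  (hdelta : 1 / 2 < delta) (hgamma : theta < gamma < alpha - eta)
  (he : \forall d \near \oo,
     ln d%:R `^ delta * d%:R `^ (theta / 2) <= lambda d <= d%:R `^ (gamma / 2))
  (* the unit eigenvector of the dual sample covariance matrix *)
  (v : forall d, T d -> 'cV[R]_n)
  (hvm : forall d, random_vector (v d))
  (hv : forall d w, unit_top_eigenvector
     (dual_sample_cov (data_matrix (X d) w)) (v d w)) :
  cvg_in_probability_to0 P (fun d w =>
    acos `|dot (st_estimator (data_matrix (X d) w) (v d w) (lambda d))
               (u d 1%N)|).
Proof.
move=> eps eps0.
have [[al0 al1] [th0 tha] [et0 eta_a] [thg gae]] :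
    [/\ 0 < alpha /\ alpha <= 1, 0 <= theta /\ theta < alpha,
        0 <= eta /\ eta < alpha & theta < gamma /\ gamma < alpha - eta].
  by split; apply/andP.
have hpow (e : R) : \forall d \near \oo, 0 < (d%:R : R) `^ e.
  by near=> d; apply: powR_gt0; rewrite ltr0n; near: d; exact: nbhs_infty_gt.
have [c1 [c1' [c10 _ near1]]] := same_order_near ha1 (hpow _).
have [c2' [c2 [_ c20 near2]]] := same_order_near ha2 (hpow _).
have [c3' [c3 [_ c30 near3]]] := same_order_near hc (hpow _).
have uu d : (1 <= d)%N -> dot (u d 1%N) (u d 1%N) = 1 by move=> d1; rewrite hu.
have acos_le d (w : T d) : (1 <= d)%N ->
    `|acos `|dot (st_estimator (data_matrix (X d) w) (v d w) (lambda d))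
      (u d 1%N)| | <= pi.
  move=> d1; set y := `|dot _ _|.
  have y1 : y <= 1 by exact: normalize_dot_le1 (uu _ d1).
  have y0 : 0 <= y by exact: normr_ge0.
  have y11 : -1 <= y <= 1 by rewrite y1 andbT (le_trans _ y0)// lerN10.
  by rewrite ger0_norm ?acos_ge0// acos_lepi.
have [epi|epi] := leP pi eps.
  apply: cvg_near_cst; near=> d.
  rewrite (_ : [set w | _] = set0) ?measure0//.
  rewrite -subset0 => w /=; apply/negP; rewrite -leNgt (le_trans _ epi)//.
  by apply: acos_le; near: d; exact: nbhs_infty_ge.
have cos1 : cos eps < 1.
  by rewrite -cos0 ltr_cos// in_itv/= ?lexx ?pi_ge0// (ltW eps0) ltW.
(* K is chosen so that (K - 1) / (K + 1), the cosine guaranteed by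
   st_estimator_failure_le, is at least cos eps. *)
pose K := 3 + 2 / (1 - cos eps).
have K3 : 2 < K.
  have : 0 <= 2 / (1 - cos eps) by rewrite divr_ge0// subr_ge0 ltW.
  by rewrite /K; move: (2 / _) => q; lra.
have epsK : cos eps <= (K - 1) / (K + 1).
  rewrite ler_pdivlMr; last by lra.
  have : (1 - cos eps) * (K + 1) = 4 * (1 - cos eps) + 2.
    by rewrite /K; field; rewrite gt_eqF// subr_gt0.
  by have := cos1; move: (cos eps) => c h1 h2; nra.
(* kappa is the exponent left between the required size of the signal
   coefficient and the square root of the first eigenvalue. *)
pose kappa := (alpha - eta - gamma) / 2.
have kappa0 : 0 < kappa by rewrite /kappa; lra.
pose M := 6 * K * c3 / Num.sqrt c1.
pose B d : R := 2 * n%:R * d%:R `^ (- 1) + M * d%:R `^ (- kappa).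
have B0 : B d @[d --> \oo] --> (0 : R).
  suff : B d @[d --> \oo] --> (2 * n%:R * 0 + M * 0 : R) by rewrite !mulr0 addr0.
  apply: cvgD; (apply: cvgM; first exact: cvg_cst); exact: powR_nat_cvg0.
have PB : \forall d \near \oo, (0 <= P d [set w | (eps < `|acos `|dot (st_estimator
    (data_matrix (X d) w) (v d w) (lambda d)) (u d 1%N)| |)%R] <= (B d)%:E)%E.
  near=> d.
  have d2 : (2 <= d)%N by near: d; exact: nbhs_infty_ge.
  have d0 : (0 < d)%N by exact: ltnW.
  have dR : 0 < d%:R :> R by rewrite ltr0n.
  have dn0 : d%:R != 0 :> R by rewrite gt_eqF.
  have ln1 : 1 <= ln (d%:R : R) by near: d; exact: ln_nat_ge_near.
  have ln0 : 0 < ln (d%:R : R) by exact: lt_le_trans ln1.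
  have /andP[l1 _] : c1 * d%:R `^ alpha <= lam d 1%N <= c1' * d%:R `^ alpha
    by near: d; exact: near1.
  have /andP[_ l2] : c2' * d%:R `^ theta <= lam d 2%N <= c2 * d%:R `^ theta
    by near: d; exact: near2.
  have /andP[_ l3] : c3' * d%:R `^ (eta / 2) <=
      \big[Num.max/0]_(i < d | (i < Num.truncn (d%:R `^ beta))%N)
      `|u d 1%N i 0|^-1 <= c3 * d%:R `^ (eta / 2) by near: d; exact: near3.
  have /andP[t1 t2] : ln d%:R `^ delta * d%:R `^ (theta / 2) <= lambda d <=
      d%:R `^ (gamma / 2) by near: d; exact: he.
  have t0 : 0 < lambda d by apply: lt_le_trans t1; rewrite mulr_gt0// powR_gt0.
  pose L := c2 * d%:R `^ theta.
  have L0 : 0 < L by rewrite mulr_gt0// powR_gt0.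
  have lamL i : (2 <= i <= d)%N -> lam d i <= L.
    by move=> /andP[i2 id]; apply: le_trans l2; apply: hlam => //; rewrite i2.
  have lam1 : 0 < lam d 1%N by apply: lt_le_trans l1; rewrite mulr_gt0// powR_gt0.
  pose tau := K * (c3 * d%:R `^ (eta / 2)) * d%:R `^ (gamma / 2).
  have K0 : 0 < K by lra.
  have tau0 : 0 < tau by rewrite !mulr_gt0// powR_gt0.
  have htau i : u d 1%N i 0 != 0 -> K * lambda d <= tau * `|u d 1%N i 0|.
    move=> ui; have ui0 : 0 < `|u d 1%N i 0| by rewrite normr_gt0.
    have h : `|u d 1%N i 0|^-1 <= c3 * d%:R `^ (eta / 2).
      apply: le_trans l3; apply: (le_bigmax_cond _ (fun i => `|u d 1%N i 0|^-1)).
      by rewrite -hsupp.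
    have h1 : 1 <= c3 * d%:R `^ (eta / 2) * `|u d 1%N i 0|.
      by rewrite -ler_pdivrMr// div1r.
    rewrite (_ : tau * _ = K * (d%:R `^ (gamma / 2) *
      (c3 * d%:R `^ (eta / 2) * `|u d 1%N i 0|))); last by rewrite /tau; ring.
    by rewrite ler_pM2l// (le_trans t2)// ler_peMr ?powR_ge0.
  rewrite measure_ge0 /=.
  apply: le_trans (st_estimator_failure_le d0 hn (hX d) L0 (@hu d) (@heig d) lam1
    lamL t0 K3 tau0 htau (@hvm d) (@hv d) _ epsK) _.
    by rewrite eps0.
  rewrite lee_fin; apply: lerD.
    have nR : 0 < n%:R :> R by rewrite ltr0n.
    have main : 2 * ln (d%:R : R) <= (lambda d / n%:R) ^+ 2 / (2 * L).
      (* A power of log d dominates any constant because 2 delta > 1; the factor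
         2 log d makes the tail beat the number d of coordinates. *)
      have big : 4 * n%:R ^+ 2 * c2 <= ln (d%:R : R) `^ (2 * delta - 1).
        have h : (4 * n%:R ^+ 2 * c2) `^ (2 * delta - 1)^-1 <= ln (d%:R : R).
          by near: d; exact: ln_nat_ge_near.
        have e0 : 0 < 2 * delta - 1 by lra.
        have p0 : 0 <= 4 * n%:R ^+ 2 * c2 by rewrite !mulr_ge0 ?sqr_ge0// ltW.
        rewrite (_ : _ * c2 = ((4 * n%:R ^+ 2 * c2) `^ (2 * delta - 1)^-1)
            `^ (2 * delta - 1)); last first.
          by rewrite -powRrM mulVf ?lt0r_neq0// powRr1.
        apply: ge0_ler_powR => //; rewrite ?nnegrE ?powR_ge0//; exact: ltW.
      have sq : ln (d%:R : R) `^ (2 * delta - 1) * ln (d%:R : R) * d%:R `^ theta <=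
          lambda d ^+ 2.
        have -> : ln (d%:R : R) `^ (2 * delta - 1) * ln (d%:R : R) * d%:R `^ theta =
            (ln d%:R `^ delta * d%:R `^ (theta / 2)) ^+ 2.
          rewrite exprMn -!powR_mulrn ?powR_ge0// -!powRrM divfK//.
          congr (_ * _); rewrite -[X in _ * X]powRr1 ?ltW// -powRD.
            by congr (_ `^ _); ring.
          by rewrite (gt_eqF ln0) implybT.
        by rewrite ler_sqr ?nnegrE ?mulr_ge0 ?powR_ge0// ltW.
      have twoL : 0 < 2 * L by rewrite mulr_gt0.
      rewrite ler_pdivlMr// exprMn exprVn ler_pdivlMr ?exprn_gt0//.
      apply: le_trans sq.
      rewrite (_ : _ * _ * _ = (4 * n%:R ^+ 2 * c2) * ln d%:R * d%:R `^ theta).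
        by rewrite !ler_wpM2r ?powR_ge0// ltW.
      by rewrite /L; ring.
    have he2 : expR (- ((lambda d / n%:R) ^+ 2 / (2 * L))) <=
        d%:R `^ (- 1) * d%:R `^ (- 1).
      rewrite -powRD ?dn0 ?implybT// /powR (negbTE dn0) ler_expR.
      rewrite (_ : _ * ln d%:R = - (2 * ln d%:R)); last by ring.
      by rewrite lerN2.
    apply: (@le_trans _ _ (d%:R * n%:R * (2 * (d%:R `^ (- 1) * d%:R `^ (- 1))))).
      by apply: ler_wpM2l; [rewrite mulr_ge0|exact: ler_wpM2l].
    rewrite powR_inv1 ?ler0n// le_eqVlt; apply/orP; left; apply/eqP; field.
    by [].
  have sl : Num.sqrt c1 * d%:R `^ (alpha / 2) <= Num.sqrt (lam d 1%N).
    rewrite powRrM powR12_sqrt ?powR_ge0// -sqrtrM ?(ltW c10)//.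
    exact: ler_wsqrtr.
  have sc : 0 < Num.sqrt c1 by rewrite sqrtr_gt0.
  have pa : 0 < (d%:R : R) `^ (alpha / 2) by rewrite powR_gt0.
  apply: (@le_trans _ _ (6 * tau / (Num.sqrt c1 * d%:R `^ (alpha / 2)))).
    apply: ler_wpM2l; first by rewrite mulr_ge0// ltW.
    by rewrite lef_pV2 ?posrE ?mulr_gt0 ?sqrtr_gt0.
  rewrite (_ : d%:R `^ (- kappa) = d%:R `^ (eta / 2) * d%:R `^ (gamma / 2) *
      (d%:R `^ (alpha / 2))^-1); last first.
    rewrite -powRN -!powRD ?dn0 ?implybT//; congr (_ `^ _).
    by rewrite /kappa; field.
  rewrite /M /tau le_eqVlt; apply/orP; left; apply/eqP; field.
  by rewrite !gt_eqF.
have BE : (B d)%:E @[d --> \oo] --> (0 : \bar R)%E.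
  by apply: cvg_EFin; [exact: nearW|exact: B0].
exact: (squeeze_cvge PB (cvg_cst _) BE).
Unshelve. all: by end_near. Qed.
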